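(* Let $(\Gamma,\psi)$ be a model of $T_{\log}$, let $n\geq1$ and suppose that $f:\Psi^n\to\Psi$ is a function definable (with parameters) in $(\Gamma,\psi)$. Then $f$ is definable (with parameters from $\Psi$) in the structure $(\Psi;<)$, where $<$ is the ordering on $\Psi$ induced from $\Gamma$.
   Context: Asymptotic couples. An asymptotic couple is a pair $(\Gamma,\psi)$ where $\Gamma$ is a (totally) ordered abelian group and $\psi:\Gamma^{\neq}\to\Gamma$ (with $\Gamma^{\neq}=\Gamma\setminus\{0\}$) satisfies for all $\alpha,\beta\in\Gamma^{\neq}$: (AC1) $\alpha+\beta\neq0\Rightarrow\psi(\alpha+\beta)\geq\min(\psi(\alpha),\psi(\beta))$; (AC2) $\psi(r\alpha)=\psi(\alpha)$ for all nonzero $r\in\mathbb{Z}$; (AC3) $\alpha>0\Rightarrow\alpha+\psi(\alpha)>\psi(\beta)$. It is $H$-asymptotic (of $H$-type) if moreover $0<\alpha\leq\beta\Rightarrow\psi(\alpha)\geq\psi(\beta)$, and divisible if $\Gamma$ is divisible. Put $\Psi=\psi(\Gamma^{\neq})$ and $\gamma'=\gamma+\psi(\gamma)$ for $\gamma\in\Gamma^{\neq}$. $(\Gamma,\psi)$ has asymptotic integration if $\{\gamma':\gamma\in\Gamma^{\neq}\}=\Gamma$; if it is also of $H$-type, then for each $\alpha\in\Gamma$ there is a unique $\beta\in\Gamma^{\neq}$ with $\beta'=\alpha$, denoted $\int\alpha$, and the successor function is $s:\Gamma\to\Psi$, $s(\alpha)=\psi(\int\alpha)$; write $s\alpha=s(\alpha)$,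 so $s0=s(0)$. The theory $T_{\log}$. Let $L_0=\{0,+,-,<,\psi,\infty\}$. An asymptotic couple is an $L_0$-structure with underlying set $\Gamma_\infty=\Gamma\cup\{\infty\}$, $\Gamma<\infty$, and $\infty$ as default value: $-\infty=\gamma+\infty=\infty+\gamma=\infty+\infty=\psi(0)=\psi(\infty)=\infty$. $T_0$ is the $L_0$-theory whose models are the divisible $H$-asymptotic couples with asymptotic integration such that: $\Psi$ has a least element, equal to $s0$, and $s0>0$; every $\alpha\in\Psi$ has an immediate successor in the ordered set $\Psi$, namely $s\alpha$; and $\gamma\mapsto s\gamma:\Psi\to\Psi^{>s0}=\{x\in\Psi:x>s0\}$ is a bijection. For a model of $T_0$ let $p:\Psi^{>s0}\to\Psi$ be the inverse of this bijection, extended to $\Gamma_\infty$ by $p(\alpha)=\infty$ for $\alpha\in\Gamma_\infty\setminus\Psi^{>s0}$. Let $L=L_0\cup\{s,p,\delta_1,\delta_2,\dots\}$ with all new symbols unary function symbols; models of $T_0$ are construed as $L$-structures with $s$ interpreted as the successor function $\alpha\mapsto\psi(\int\alpha)$ on $\Gamma$ and $s(\infty)=\infty$, $p$ interpreted as the function $p:\Gamma_\infty\to\Gamma_\infty$ that inverts $\gamma\mapsto s\gamma:\Psi\to\Psi^{>s0}$ on $\Psi^{>s0}$ and takes the value $\infty$ elsewhere, and $\delta_n$ interpreted as division by $n$ ($\delta_n(\infty)=\infty$). $T_{\log}$ is the $L$-theory whose models are the models of $T_0$ so construed. *)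

(* Defs.v *)
From HB Require Import structures.
From mathcomp Require Import all_boot all_order all_algebra.
From mathcomp Require Import boolp classical_sets functions.

Set Implicit Arguments.
Unset Strict Implicit.
Unset Printing Implicit Defensive.

Import Order.TTheory GRing.Theory Num.Theory.

Local Open Scope classical_set_scope.
Local Open Scope ring_scope.

Record language := Language {
  fsym : Type; farity : fsym -> nat;
  rsym : Type; rarity : rsym -> nat }.

Record structure (L : language) := Structure {
  dom :> Type;
  fint : forall F : fsym L, ('I_(farity F) -> dom) -> dom;
  rint : forall P : rsym L, ('I_(rarity P) -> dom) -> Prop }.

Inductive term (L : language) (V : Type) : Type :=
| Var of V
| App (F : fsym L) of ('I_(farity F) -> term L V).

(* [formula L V]: formulas whose free variables are taken from [V].  Under a
   quantifier the variables are [option V], [None] being the bound one.  The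
   connectives [Bot], [Imp], [All] are complete, as [sat] lands in [Prop] and
   the logic is classical. *)
Inductive formula (L : language) (V : Type) : Type :=
| Bot
| Eq of term L V & term L V
| Rel (P : rsym L) of ('I_(rarity P) -> term L V)
| Imp of formula L V & formula L V
| All of formula L (option V).

Fixpoint eval (L : language) (M : structure L) (V : Type) (e : V -> M)
    (t : term L V) : M :=
  match t with
  | Var x => e x
  | App F ts => fint (fun i => eval e (ts i))
  end.

Fixpoint sat (L : language) (M : structure L) (V : Type)
    (phi : formula L V) : (V -> M) -> Prop :=
  match phi with
  | Bot => fun _ => False
  | Eq t u => fun e => eval e t = eval e u
  | Rel P ts => fun e => rint (fun i => eval e (ts i))
  | Imp phi1 phi2 => fun e => sat phi1 e -> sat phi2 e
  | All phi1 => fun e =>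
      forall a : M, sat phi1 (fun v => if v is Some x then e x else a)
  end.

(* Definability with parameters of a subset of [M ^ k]: the variables
   [inl i] of the formula are the coordinates, and a variable [inr a] is a
   constant naming the element [a] of [M]. *)
Definition definable (L : language) (M : structure L) (k : nat)
    (D : set ('I_k -> M)) : Prop :=
  exists phi : formula L ('I_k + M),
    forall x : 'I_k -> M,
      D x <-> sat phi (fun v => match v with inl i => x i | inr a => a end).

(* For [iota] injective, [X] is viewed as a subset of [M]; the graph of
   [f : X ^ n -> X] is then a subset of [M ^ n.+1], the last coordinate being
   the value. *)
Definition definable_fun (L : language) (M : structure L) (X : Type)
    (iota : X -> M) (n : nat) (f : ('I_n -> X) -> X) : Prop :=
  definable [set v : 'I_n.+1 -> M | exists x : 'I_n -> X,
    (forall i : 'I_n, v (lift ord_max i) = iota (x i)) /\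
    v ord_max = iota (f x)].

(* [porderZmodType] carries no compatibility between order and addition. *)
HB.mixin Record POrderedZmodule_isOrdered V of Num.POrderedZmodule V := {
  leog_total : forall x y : V, (x <= y) || (y <= x);
  leog_add2l : forall z x y : V, x <= y -> z + x <= z + y }.

#[short(type="orderedZmodType")]
HB.structure Definition OrderedZmodule :=
  { V of POrderedZmodule_isOrdered V & Num.POrderedZmodule V }.

(* The map [psi] is only meaningful on nonzero elements; [psi 0] is an
   arbitrary value that nothing below depends on. *)
Section AsymptoticCouples.
Variables (G : orderedZmodType) (psi : G -> G).

Record asymptotic_couple : Prop := AsymptoticCouple {
  ac1 : forall a b : G, a != 0 -> b != 0 -> a + b != 0 ->
    Order.min (psi a) (psi b) <= psi (a + b);
  ac2 : forall (a : G) (r : int), a != 0 -> r != 0 -> psi (a *~ r) = psi a;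
  ac3 : forall a b : G, a != 0 -> b != 0 -> 0 < a -> psi b < a + psi a }.

Definition H_type : Prop :=
  forall a b : G, 0 < a -> a <= b -> psi b <= psi a.

Definition divisible : Prop :=
  forall (n : nat) (a : G), (0 < n)%N -> exists b : G, b *+ n = a.

Definition Psi : set G := psi @` [set a | a != 0].

Definition der (a : G) : G := a + psi a.

Definition asymptotic_integration : Prop := der @` [set a | a != 0] = setT.

Definition integral (a : G) : G := xget 0 [set b | b != 0 /\ der b = a].

Definition succ (a : G) : G := psi (integral a).

Definition Psi_gt_s0 : set G := Psi `&` [set a | succ 0 < a].

Record model_T0 : Prop := ModelT0 {
  T0_couple : asymptotic_couple;
  T0_H_type : H_type;
  T0_divisible : divisible;
  T0_integration : asymptotic_integration;
  T0_s0_Psi : Psi (succ 0);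
  T0_s0_least : forall a, Psi a -> succ 0 <= a;
  T0_s0_gt0 : 0 < succ 0;
  T0_succ_immediate : forall a, Psi a ->
    [/\ Psi (succ a), a < succ a &
        forall b, Psi b -> a < b -> succ a <= b];
  T0_succ_bij : set_bij Psi Psi_gt_s0 succ }.

Definition pred_Psi (a : G) : G := xget 0 [set b | Psi b /\ succ b = a].

Definition div_by (n : nat) (a : G) : G := xget 0 [set b | b *+ n = a].

(* [FDelta n] is the symbol for division by [n.+1]. *)
Inductive log_fsym :=
  FZero | FAdd | FOpp | FPsi | FInfty | FSucc | FPred | FDelta of nat.

Definition log_farity (F : log_fsym) : nat :=
  match F with
  | FZero | FInfty => 0
  | FAdd => 2
  | FOpp | FPsi | FSucc | FPred | FDelta _ => 1
  end%N.

Inductive lt_rsym := RLt.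

Definition lt_rarity (_ : lt_rsym) : nat := 2.

Definition L_log : language := Language log_farity lt_rarity.

Definition L_lt : language :=
  Language (fun F : void => match F return nat with end) lt_rarity.

(* The underlying set is [option G], with [None] standing for infinity. *)
Definition log_fint (F : log_fsym) :
    ('I_(log_farity F) -> option G) -> option G :=
  match F return ('I_(log_farity F) -> option G) -> option G with
  | FZero => fun _ => Some 0
  | FInfty => fun _ => None
  | FAdd => fun x =>
      match x ord0, x ord_max with
      | Some a, Some b => Some (a + b)
      | _, _ => None
      end
  | FOpp => fun x => omap (fun a => - a) (x ord0)
  | FPsi => fun x =>
      obind (fun a => if a == 0 then None else Some (psi a)) (x ord0)
  | FSucc => fun x => omap succ (x ord0)
  | FPred => fun x =>
      obind (fun a => if a \in Psi_gt_s0 then Some (pred_Psi a) else None)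
            (x ord0)
  | FDelta n => fun x => omap (div_by n.+1) (x ord0)
  end.

Definition lt_infty (a b : option G) : Prop :=
  match a, b with
  | Some a, Some b => a < b
  | Some _, None => True
  | None, _ => False
  end.

Definition log_structure : structure L_log :=
  @Structure L_log (option G) log_fint
    (fun P : lt_rsym => match P return ('I_(lt_rarity P) -> option G) -> Prop
                        with RLt => fun x => lt_infty (x ord0) (x ord_max) end).

(* The carrier is the set [Psi] coerced to the type [{a | a \in Psi}]. *)
Definition Psi_structure : structure L_lt :=
  @Structure L_lt Psi (fun F : void => match F with end)
    (fun P : lt_rsym => match P return ('I_(lt_rarity P) -> Psi) -> Prop
                        with RLt => fun x => val (x ord0) < val (x ord_max) end).

Definition Psi_incl (a : Psi) : log_structure := Some (val a).

End AsymptoticCouples.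

(* Main.v *)
Require Import Defs.
From HB Require Import structures.
From mathcomp Require Import all_boot all_order all_algebra.
From mathcomp Require Import boolp classical_sets functions cardinality filter.
From mathcomp Require Import generic_quotient ring.

Set Implicit Arguments.
Unset Strict Implicit.
Unset Printing Implicit Defensive.

Import Order.TTheory GRing.Theory Num.Theory.

Local Open Scope classical_set_scope.
Local Open Scope ring_scope.
Local Open Scope quotient_scope.

(* All of [Psi] is stably embedded, which gives the statement for functions.

   Suppose that a subset of [Psi^m] definable in the couple is not definable in
   [(Psi; <)].  Then for every [k] there are tuples [x_k] in the set and [y_k]
   outside it that satisfy the same conditions [s^j t <= t'], where [j] and the
   [t], [t'] (coordinates, or elements of a countable substructure containing
   the parameters) range over the first [k] possibilities.  In an ultrapower the
   classes of [(x_k)] and [(y_k)] satisfy exactly the same conditions, and they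
   are distinguished by the formula.  But the ultrapower is saturated, and there
   the isomorphisms between countable substructures form a back-and-forth
   system, one of which maps the first tuple to the second:

   - Adjoining to the domain [A] an element [x] of [Psi] outside of it, together
     with all [s^i x].  The cut of [x] in [A] determines everything, because
     every [a] in [A] has a well-defined place [z = s a] where it ceases to
     resemble the elements of [Psi]: [psi (a - z) = z].
   - Adjoining any [c], after all values [psi (c - a)] have been adjoined.  One
     has to realize the cut of [c] together with these values; by convexity of
     [psi] only the two neighbours of [c] among finitely many [a] matter. *)

(** * Ordered groups *)

(** Comparing two tuples inside one countably saturated couple replaces a quantifier elimination for
    the whole theory. The price is that only countably many conditions can be realized at once, so
    every partial isomorphism is kept countable. The conditions [s^j t <= t'] suit both sides of the
    argument: they are expressible in [(Psi; <)], where [s] is the immediate successor, and they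
    determine how each coordinate is placed relative to the galaxies (orbits under [s] and its
    inverse) of the other coordinates and of the constants. An element of [Psi] brings its whole
    galaxy because substructures are closed under [s] and [p]. The difficulty is that [psi] and [s]
    also act on the group generated by the galaxy over the old domain; all values and successors
    arising there have to be found in the old domain or in the galaxy. The values [psi (c - a)] are
    adjoined ahead of [c] so that [c] itself contributes no element of [Psi]; everything new is then
    of the form [(a + m c) / N]. *)

Section LinearCombinations.

Inductive lexpr : Type :=
| LVar of nat
| LZero
| LAdd of lexpr & lexpr
| LOpp of lexpr
| LMulz of lexpr & int
| LMuln of lexpr & nat.

Variable V : zmodType.

Fixpoint leval (e : seq V) (t : lexpr) : V :=
  match t with
  | LVar i => nth 0 e i
  | LZero => 0
  | LAdd t1 t2 => leval e t1 + leval e t2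
  | LOpp t1 => - leval e t1
  | LMulz t1 m => leval e t1 *~ m
  | LMuln t1 m => leval e t1 *+ m
  end.

Fixpoint lcoef (i : nat) (t : lexpr) : int :=
  match t with
  | LVar j => if eqn j i then 1 else 0
  | LZero => 0
  | LAdd t1 t2 => lcoef i t1 + lcoef i t2
  | LOpp t1 => - lcoef i t1
  | LMulz t1 m => lcoef i t1 * m
  | LMuln t1 m => lcoef i t1 * m%:Z
  end.

Lemma leval_coef (e : seq V) (t : lexpr) :
  leval e t = \sum_(i < size e) nth 0 e i *~ lcoef i t.
Proof.
elim: t => [j||t1 IH1 t2 IH2|t1 IH1|t1 IH1 m|t1 IH1 m] /=.
- case: (ltnP j (size e)) => hj; last first.
    rewrite nth_default // big1 // => i _.
    by rewrite -[eqn _ _]/(j == i) gtn_eqF ?mulr0z // (leq_trans (ltn_ord i)).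
  rewrite (bigD1 (Ordinal hj)) //= -[eqn _ _]/(j == j) eqxx mulr1z big1 ?addr0 //.
  move=> i ij; rewrite -[eqn _ _]/(j == i).
  case: eqP => [ji|]; last by rewrite mulr0z.
  by case/eqP: ij; apply/val_inj.
- by rewrite big1 // => i _; rewrite mulr0z.
- by rewrite IH1 IH2 -big_split; apply: eq_bigr => i _; rewrite mulrzDr.
- by rewrite IH1 -sumrN; apply: eq_bigr => i _; rewrite mulrNz.
- by rewrite IH1 mulrz_suml; apply: eq_bigr => i _; rewrite mulrzA.
- by rewrite IH1 -sumrMnl; apply: eq_bigr => i _; rewrite mulrzA -pmulrn.
Qed.

(** A bounded conjunction defined by recursion, so that for a concrete length [cbn] unfolds it into
    separate integer identities for [ring]. For the same reason [lcoef] compares indices by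
    [eqn]. *)
Fixpoint all_coef (k : nat) (P : nat -> Prop) : Prop :=
  match k with
  | 0%N => True
  | k'.+1 => P k' /\ all_coef k' P
  end.

Lemma leval_eq (e : seq V) (t1 t2 : lexpr) :
  all_coef (size e) (fun i => lcoef i t1 = lcoef i t2) ->
  leval e t1 = leval e t2.
Proof.
move=> H; rewrite !leval_coef; apply: eq_bigr => -[i hi] _ /=; congr (_ *~ _).
move: (size e) hi H => k; elim: k => [//|k IH].
by rewrite ltnS leq_eqVlt => /predU1P[->|/IH h] /= [].
Qed.

End LinearCombinations.

Ltac lin_mem x e :=
  lazymatch e with
  | nil => constr:(false)
  | cons x _ => constr:(true)
  | cons _ ?e' => lin_mem x e'
  end.
Ltac lin_atoms t e :=
  lazymatch t with
  | @GRing.zero _ => e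
  | @GRing.add _ ?a ?b => let e1 := lin_atoms a e in lin_atoms b e1
  | @GRing.opp _ ?a => lin_atoms a e
  | intmul ?a _ => lin_atoms a e
  | @GRing.natmul _ ?a _ => lin_atoms a e
  | ?x => lazymatch lin_mem x e with
          | true => e
          | false => constr:(cons x e)
          end
  end.
Ltac lin_idx x e :=
  lazymatch e with
  | cons x _ => constr:(0%N)
  | cons _ ?e' => let i := lin_idx x e' in constr:(S i)
  end.
Ltac lin_reify t e :=
  lazymatch t with
  | @GRing.zero _ => constr:(LZero)
  | @GRing.add _ ?a ?b =>
      let u := lin_reify a e in let v := lin_reify b e in constr:(LAdd u v)
  | @GRing.opp _ ?a => let u := lin_reify a e in constr:(LOpp u)
  | intmul ?a ?m => let u := lin_reify a e in constr:(LMulz u m)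
  | @GRing.natmul _ ?a ?m => let u := lin_reify a e in constr:(LMuln u m)
  | ?x => let i := lin_idx x e in constr:(LVar i)
  end.
(* Proves an identity between integer linear combinations, the integers being
   allowed to be variables. *)
Ltac zlin :=
  lazymatch goal with
  | |- @eq ?T ?a ?b =>
    let e0 := lin_atoms a (@nil T) in
    let e := lin_atoms b e0 in
    let u := lin_reify a e in
    let v := lin_reify b e in
    change (leval e u = leval e v); apply: leval_eq;
    cbn [size all_coef lcoef eqn]; repeat split; try ring
  end.

Section OrderedGroups.
Variable G : orderedZmodType.
Implicit Types a b c x y z : G.

Lemma og_leD2l c a b : (c + a <= c + b) = (a <= b).
Proof.
apply/idP/idP => [h|]; last exact: leog_add2l.
by have := leog_add2l (- c) _ _ h; rewrite !addKr.
Qed.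

Lemma og_total a b : (a <= b) || (b <= a).
Proof. exact: leog_total. Qed.

Lemma og_leNgt a b : (a <= b) = ~~ (b < a).
Proof.
have lea (c d : G) : c <= d -> ~~ (d < c).
  by move=> h; apply/negP => h'; have := le_lt_trans h h'; rewrite ltxx.
case/orP: (og_total a b) => h; first by rewrite h lea.
case: (eqVneq a b) => [->|ne]; first by rewrite lexx ltxx.
have hlt : b < a by rewrite lt_neqAle eq_sym ne.
by rewrite hlt; apply/negP => /lea; rewrite hlt.
Qed.

Lemma og_ltNge a b : (a < b) = ~~ (b <= a).
Proof. by rewrite og_leNgt negbK. Qed.

Lemma og_ltD2l c a b : (c + a < c + b) = (a < b).
Proof. by rewrite !og_ltNge og_leD2l. Qed.

Lemma og_subr_gt0 a b : (0 < b - a) = (a < b).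
Proof. by rewrite -(og_ltD2l a 0) addr0 addrC subrK. Qed.

Lemma og_oppr_gt0 a : (0 < - a) = (a < 0).
Proof. by rewrite -(og_ltD2l a 0) addr0 subrr. Qed.

Lemma og_addr_gt0 a b : 0 < a -> 0 <= b -> 0 < a + b.
Proof.
by move=> ha hb; apply: (lt_le_trans ha); rewrite -{1}[a]addr0 og_leD2l.
Qed.

Lemma og_cases a : [\/ a < 0, a = 0 | 0 < a].
Proof.
case: (eqVneq a 0) => [->|ne]; first by constructor 2.
case/orP: (og_total a 0) => h; [constructor 1|constructor 3];
  by rewrite lt_neqAle h ?ne // eq_sym ne.
Qed.

Lemma og_muln_gt0 a n : 0 < a -> 0 < a *+ n.+1.
Proof.
move=> ha; elim: n => [|n IH]; first by rewrite mulr1n.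
by rewrite mulrS; apply: og_addr_gt0 => //; apply: ltW.
Qed.

Lemma og_muln_pos a n : (0 < a *+ n.+1) = (0 < a).
Proof.
case: (og_cases a) => [h|->|h].
- have := og_muln_gt0 n (etrans (og_oppr_gt0 a) h).
  rewrite mulNrn og_oppr_gt0 => h'.
  by rewrite (lt_gtF h) (lt_gtF h').
- by rewrite mul0rn.
- by rewrite h og_muln_gt0.
Qed.

Lemma og_mulz_eq0 a (m : int) : a != 0 -> m != 0 -> a *~ m != 0.
Proof.
wlog ha : a / 0 < a => [hw ne|].
  case: (og_cases a) => [h|h|h]; last exact: hw.
    move=> hm; have := hw (- a) (etrans (og_oppr_gt0 a) h); rewrite oppr_eq0.
    by move=> /(_ ne hm); rewrite mulNrz oppr_eq0.
  by rewrite h eqxx in ne.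
case: m => [[//|n]|n] _ _.
  by apply/eqP => h; have := og_muln_gt0 n ha; rewrite pmulrn h ltxx.
apply/eqP => h; have := og_muln_gt0 n ha.
by rewrite pmulrn -[X in 0 < X]opprK -mulrNz -NegzE h oppr0 ltxx.
Qed.

Lemma og_muln_inj n a b : a *+ n.+1 = b *+ n.+1 -> a = b.
Proof.
move=> h; apply/eqP; rewrite -subr_eq0; apply/negP => /negP ne.
have := @og_mulz_eq0 _ n.+1 ne isT; rewrite -pmulrn mulrnBl h subrr.
by rewrite eqxx.
Qed.

Lemma og_gt0_neq0 a : 0 < a -> a != 0.
Proof. by move=> h; rewrite gt_eqF. Qed.

End OrderedGroups.

(** * Asymptotic couples with successor *)

Section CoupleFacts.
Variables (G : orderedZmodType) (psi : G -> G).
Hypothesis HT : model_T0 psi.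
Implicit Types a b c d r u x y z : G.

Local Notation Psi := (Psi psi).
Local Notation succ := (succ psi).

Lemma psi_Psi a : a != 0 -> Psi (psi a).
Proof. by move=> ha; exists a. Qed.

Lemma psi_mulz a (m : int) : m != 0 -> psi (a *~ m) = psi a.
Proof.
move=> hm; case: (eqVneq a 0) => [->|ha]; first by rewrite mul0rz.
exact: (ac2 (T0_couple HT)).
Qed.

Lemma psi_muln a n : psi (a *+ n.+1) = psi a.
Proof. by rewrite pmulrn psi_mulz. Qed.

Lemma psiN a : psi (- a) = psi a.
Proof. by rewrite -(@psi_mulz a (-1)) // mulrN1z. Qed.

Lemma psiBC a b : psi (a - b) = psi (b - a).
Proof. by rewrite -psiN opprB. Qed.

(* [r] is negligible at level [x]; the zero element always is. *)
Definition small r x := r != 0 -> x < psi r.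

Lemma small0 x : small 0 x.
Proof. by rewrite /small eqxx. Qed.

Lemma smallD a b x : small a x -> small b x -> small (a + b) x.
Proof.
move=> ha hb; case: (eqVneq a 0) => [->|na]; first by rewrite add0r.
case: (eqVneq b 0) => [->|nb]; first by rewrite addr0.
move=> nab; apply: lt_le_trans (ac1 (T0_couple HT) na nb nab).
by rewrite minEle; case: ifP => _; [exact: ha|exact: hb].
Qed.

Lemma smallMz a x (m : int) : small a x -> small (a *~ m) x.
Proof.
move=> ha; case: (eqVneq m 0) => [->|hm]; first by rewrite mulr0z; exact: small0.
by move=> h; rewrite psi_mulz //; apply: ha; apply: contraNneq h => ->; rewrite mul0rz.
Qed.

Lemma smallN a x : small a x -> small (- a) x.
Proof. by move=> ha; rewrite -mulrN1z; apply: smallMz. Qed.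

Lemma smallB a b x : small a x -> small b x -> small (a - b) x.
Proof. by move=> ha hb; apply: smallD => //; apply: smallN. Qed.

Lemma small_le a x y : x <= y -> small a y -> small a x.
Proof. by move=> hxy ha /ha; apply: le_lt_trans. Qed.

(** [psi] acts as a valuation in which a larger value means a smaller element. AC1 for [d + r] and
    for [d = (d + r) - r] pins down the value. The sign survives because [0 < d] and [d + r <= 0]
    would give [d <= - r], hence [psi r <= psi d] by convexity. *)
Lemma small_dom d r : d != 0 -> small r (psi d) ->
  [/\ d + r != 0, psi (d + r) = psi d & (0 < d + r) = (0 < d)].
Proof.
move=> nd hr.
have nz : d + r != 0.
  apply/eqP => h; have hrd : r = - d by rewrite -[LHS](addKr d) h addr0.
  have : psi d < psi r by apply: hr; rewrite hrd oppr_eq0.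
  by rewrite hrd psiN ltxx.
case: (eqVneq r 0) => [->|nr]; first by rewrite addr0.
have hr' := hr nr; have [c1 _ _] := T0_couple HT.
have e1 : psi d <= psi (d + r).
  by have := c1 _ _ nd nr nz; rewrite min_l // ltW.
have e2 : psi (d + r) <= psi d.
  have := @c1 (d + r) (- r) nz; rewrite oppr_eq0 addrK psiN => /(_ nr nd).
  by rewrite minEle; case: ifP => // _; rewrite og_leNgt hr'.
split=> //; first by apply/le_anti; rewrite e1 e2.
have pos a b : 0 < a -> psi a < psi b -> 0 < a + b.
  move=> ha hb; rewrite og_ltNge; apply/negP => h.
  have : a <= - b by rewrite -(og_leD2l b) subrr addrC.
  by move=> /(T0_H_type HT ha); rewrite psiN og_leNgt hb.
case: (og_cases d) => [h|h|h].
- have : 0 < - d + - r by apply: pos; rewrite ?og_oppr_gt0 ?psiN.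
  by rewrite -opprD og_oppr_gt0 => h'; rewrite (lt_gtF h) (lt_gtF h').
- by rewrite h eqxx in nd.
- by rewrite h pos.
Qed.

Lemma Psi_succ x : Psi x -> Psi (succ x).
Proof. by move=> /(T0_succ_immediate HT)[]. Qed.

Lemma lt_succ x : Psi x -> x < succ x.
Proof. by move=> /(T0_succ_immediate HT)[]. Qed.

Lemma succ_le x y : Psi x -> Psi y -> (succ x <= y) = (x < y).
Proof.
move=> hx hy; case/(T0_succ_immediate HT): (hx) => _ h1 h2.
by apply/idP/idP => [|/h2->//]; apply: lt_le_trans.
Qed.

(** If [a < b] had the same derivative, then [b - a = psi a - psi b > 0], so [b] dominates [a] and
    [psi (b - a) = psi b]. Then [(b - a) + psi (b - a) = psi a], against AC3. *)
Lemma der_inj a b : a != 0 -> b != 0 -> der psi a = der psi b -> a = b.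
Proof.
wlog hab : a b / a < b => [hw ha hb h|ha hb h].
  case: (eqVneq a b) => // ne; case/orP: (og_total a b) => hle.
    by apply: hw => //; rewrite lt_neqAle ne.
  by apply/esym/hw => //; rewrite lt_neqAle eq_sym ne.
have hd : 0 < b - a by rewrite og_subr_gt0.
have e : psi a - psi b = b - a.
  have e0 : a + psi a = b + psi b by [].
  have -> : psi a = b + psi b - a by rewrite -e0; zlin.
  by zlin.
have hlt : psi b < psi a by rewrite -og_subr_gt0 e.
have [_ epsi _] : [/\ b + - a != 0, psi (b + - a) = psi b & (0 < b + - a) = (0 < b)].
  by apply: small_dom => // _; rewrite psiN.
have := ac3 (T0_couple HT) (og_gt0_neq0 hd) ha hd.
by rewrite epsi -e subrK ltxx.
Qed.

Lemma integralP u : integral psi u != 0 /\ der psi (integral psi u) = u.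
Proof.
have : [set b | b != 0 /\ der psi b = u] (integral psi u); last by [].
have : [set: G] u by []; rewrite -(T0_integration HT) => -[b hb e].
by apply: xgetPex; exists b.
Qed.

(** With [v] the integral of [u], the equation [v + psi v = u] reads [u - s u = v]. Thus [s u] is
    the unique [z] with [z != u] and [psi (u - z) = z]; the extension arguments use this fixed-point
    description in place of the integral. *)
Lemma succP u : [/\ Psi (succ u), u - succ u != 0 & psi (u - succ u) = succ u].
Proof.
have [h1 h2] := integralP u.
have e : u - succ u = integral psi u by rewrite -{1}h2 /der addrK.
by rewrite e; split => //; apply: psi_Psi.
Qed.

Lemma succ_eq u z : u - z != 0 -> psi (u - z) = z -> succ u = z.
Proof.
move=> h1 h2; have [h3 h4] := integralP u.
suff e : integral psi u = u - z by rewrite /Defs.succ e.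
by apply: der_inj => //; rewrite h4 /der h2 subrK.
Qed.

(** Convexity applied to [s x - x <= y - x] gives one inequality. For the other, [psi (y - x) <= x]
    would make [(y - x) + psi (y - x) <= y], against AC3 since [y] is itself a value. *)
Lemma psi_PsiB x y : Psi x -> Psi y -> x < y -> psi (y - x) = succ x.
Proof.
move=> hx hy hxy; have [hs n1 e1] := succP x.
have hd : 0 < y - x by rewrite og_subr_gt0.
have h1 : 0 < succ x - x by rewrite og_subr_gt0 lt_succ.
apply/le_anti/andP; split.
  have := @T0_H_type _ _ HT (succ x - x) (y - x) h1.
  rewrite (psiBC (succ x)) e1; apply.
  by rewrite addrC [leRHS]addrC og_leD2l succ_le.
rewrite succ_le //; last exact/psi_Psi/og_gt0_neq0.
rewrite og_ltNge; apply/negP => hle.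
case: hy => b hb eb; have := ac3 (T0_couple HT) (og_gt0_neq0 hd) hb hd.
rewrite eb -[X in X < _](subrK x) og_ltD2l => h.
by have := lt_le_trans h hle; rewrite ltxx.
Qed.

Lemma psi_PsiBC x y : Psi x -> Psi y -> x < y -> psi (x - y) = succ x.
Proof. by rewrite psiBC; apply: psi_PsiB. Qed.

Lemma succ_lt x y : Psi x -> Psi y -> (succ x < succ y) = (x < y).
Proof.
move=> hx hy; apply/idP/idP; rewrite !og_ltNge; apply: contra => h.
  rewrite succ_le //; last exact: Psi_succ.
  by apply: le_lt_trans h _; exact: lt_succ.
rewrite og_leNgt; apply/negP => hxy; rewrite -(succ_le hx hy) in hxy.
by have := lt_le_trans (le_lt_trans hxy (lt_succ hy)) h; rewrite ltxx.
Qed.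

Lemma succ_mono_le x y : Psi x -> Psi y -> (succ x <= succ y) = (x <= y).
Proof. by move=> hx hy; rewrite !og_leNgt succ_lt. Qed.

Lemma lt_succ_le x y : Psi x -> Psi y -> (x < succ y) = (x <= y).
Proof. by move=> hx hy; rewrite og_ltNge succ_le // og_leNgt. Qed.

Lemma succ_inj x y : Psi x -> Psi y -> succ x = succ y -> x = y.
Proof. by move=> hx hy h; apply/le_anti; rewrite -(succ_mono_le hx hy) -(succ_mono_le hy hx) h lexx. Qed.

Lemma pred_eq x y : Psi y -> succ y = x -> pred_Psi psi x = y.
Proof.
move=> hy e; have : [set b | Psi b /\ succ b = x] (pred_Psi psi x).
  by apply: xgetPex; exists y.
by move=> [h1 h2]; apply: succ_inj; rewrite ?h2.
Qed.

Lemma predP x : Psi x -> succ 0 < x ->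
  Psi (pred_Psi psi x) /\ succ (pred_Psi psi x) = x.
Proof.
move=> h1 h2; have [_ _ h] := T0_succ_bij HT.
by have [|y hy e] := h x; first by []; rewrite (pred_eq hy e).
Qed.

(** With [t = psi (u - h)], the element [h - t] is zero or has value [s t > t]. Replacing [h] by [t]
    therefore keeps the value: [psi (u - t) = t]. *)
Lemma succ_sub_le u h : Psi h -> u != h -> psi (u - h) <= h ->
  succ u = psi (u - h).
Proof.
move=> hh ne hle; have n0 : u - h != 0 by rewrite subr_eq0.
have ht := psi_Psi n0; set t := psi (u - h) in hle ht *.
have [] : [/\ (u - h) + (h - t) != 0, psi ((u - h) + (h - t)) = psi (u - h)
    & (0 < (u - h) + (h - t)) = (0 < u - h)].
  apply: small_dom => // hn; rewrite -/t psi_PsiB ?lt_succ // lt_neqAle hle andbT.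
  by apply: contraNneq hn => ->; rewrite subrr.
rewrite addrA subrK => h1 h2 _; exact: succ_eq.
Qed.

(** In [u - s h = (h - s h) + (u - h)] the first term dominates, with value [s h]. Together with
    [succ_sub_le] this leaves [psi (u - h) = s h] as the only case in which the value does not
    reveal [s u]. *)
Lemma succ_sub_gt u h : Psi h -> small (u - h) (succ h) -> succ u = succ h.
Proof.
move=> hh hs; have n0 : h - succ h != 0 by have [] := succP h.
have e : psi (h - succ h) = succ h by have [] := succP h.
have [] : [/\ (h - succ h) + (u - h) != 0, psi ((h - succ h) + (u - h)) = psi (h - succ h)
    & (0 < (h - succ h) + (u - h)) = (0 < h - succ h)].
  by apply: small_dom => //; rewrite e.
have -> : h - succ h + (u - h) = u - succ h by zlin.
by rewrite e => h1 h2 _; apply: succ_eq.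
Qed.

Lemma div_byK n u : div_by n.+1 u *+ n.+1 = u.
Proof.
have : [set b | b *+ n.+1 = u] (div_by n.+1 u); last by [].
by apply: xgetPex; apply: (T0_divisible HT).
Qed.

Lemma div_by_eq n u b : b *+ n.+1 = u -> div_by n.+1 u = b.
Proof. by move=> e; apply: (@og_muln_inj _ n); rewrite div_byK. Qed.

End CoupleFacts.

(** * Partial isomorphisms *)

Fixpoint tvars (L : language) (V : Type) (t : term L V) : set V :=
  match t with
  | Var x => [set x]
  | App F ts => \bigcup_i tvars (ts i)
  end.

Fixpoint fvars (L : language) (V : Type) (phi : formula L V) : set V :=
  match phi with
  | Bot => set0
  | Eq t u => tvars t `|` tvars u
  | Rel P ts => \bigcup_i tvars (ts i)
  | Imp phi1 phi2 => fvars phi1 `|` fvars phi2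
  | All phi1 => [set x | fvars phi1 (Some x)]
  end.

Section PartialIsomorphisms.
Variables (G : orderedZmodType) (psi : G -> G).
Hypothesis HT : model_T0 psi.
Implicit Types (a b c d u x y z : G) (S T : G -> G -> Prop).

Local Notation Psi := (Psi psi).
Local Notation succ := (succ psi).
Local Notation pred_Psi := (pred_Psi psi).

(* [S] is the graph of an isomorphism between two substructures. *)
Record good S : Prop := Good {
  good0 : S 0 0;
  goodB : forall a b c d, S a b -> S c d -> S (a - c) (b - d);
  good_div : forall n a b, S a b -> S (div_by n.+1 a) (div_by n.+1 b);
  good_pos : forall a b, S a b -> (0 < a) = (0 < b);
  good_psi : forall a b, S a b -> a != 0 -> S (psi a) (psi b);
  good_succ : forall a b, S a b -> S (succ a) (succ b);
  good_pred : forall a b, S a b -> Psi a -> Psi b -> succ 0 < a ->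
    S (pred_Psi a) (pred_Psi b) }.

Section Subgroups.
Variable S : G -> G -> Prop.
Hypotheses (S0 : S 0 0)
  (SB : forall a b c d, S a b -> S c d -> S (a - c) (b - d))
  (Spos : forall a b, S a b -> (0 < a) = (0 < b)).

Lemma subN a b : S a b -> S (- a) (- b).
Proof. by move=> h; rewrite -[- a]add0r -[- b]add0r; apply: SB. Qed.

Lemma subD a b c d : S a b -> S c d -> S (a + c) (b + d).
Proof. by move=> h1 h2; rewrite -[c]opprK -[d]opprK; apply/SB/subN. Qed.

Lemma subMz a b (m : int) : S a b -> S (a *~ m) (b *~ m).
Proof.
move=> h; have hn n : S (a *+ n) (b *+ n).
  elim: n => [|n IH]; first by rewrite !mulr0n.
  by rewrite !mulrS; apply: subD.
case: m => n; first by rewrite -!pmulrn.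
by rewrite NegzE !mulrNz -!pmulrn; apply: subN.
Qed.

Lemma sub_lt a b c d : S a b -> S c d -> (a < c) = (b < d).
Proof. by move=> h1 h2; rewrite -og_subr_gt0 -[RHS]og_subr_gt0; apply/Spos/SB. Qed.

Lemma sub_le a b c d : S a b -> S c d -> (a <= c) = (b <= d).
Proof. by move=> h1 h2; rewrite !og_leNgt (sub_lt h2 h1). Qed.

(** Functionality and injectivity follow from closure under subtraction and agreement on positivity,
    which is why partial isomorphisms can be handled as mere relations. *)
Lemma sub_eq a b c d : S a b -> S c d -> (a == c) = (b == d).
Proof.
move=> h1 h2; apply/idP/idP => /eqP e; apply/eqP/le_anti.
  by rewrite -(sub_le h1 h2) -(sub_le h2 h1) e lexx.
by rewrite (sub_le h1 h2) (sub_le h2 h1) e lexx.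
Qed.

Lemma sub_eq0 a b : S a b -> (a == 0) = (b == 0).
Proof. by move=> h; apply: sub_eq. Qed.

Lemma sub_fun a b c : S a b -> S a c -> b = c.
Proof. by move=> h1 h2; apply/eqP; rewrite -(sub_eq h1 h2). Qed.

Lemma sub_inj a b c : S a c -> S b c -> a = b.
Proof. by move=> h1 h2; apply/eqP; rewrite (sub_eq h1 h2). Qed.

End Subgroups.

(** [T] is the intended [Psi]-part of [S]. For successors it suffices that [s a] has some partner
    [y]: applying [psi] to [a - s a] and [b - y] gives [psi (b - y) = y], so [y = s b]. Conversely a
    pair of [S] in [Psi] lies in [T] because [x = p (s x)]. *)
Lemma good_of_pairs S T :
  S 0 0 ->
  (forall a b c d, S a b -> S c d -> S (a - c) (b - d)) ->
  (forall n a b, S a b -> S (div_by n.+1 a) (div_by n.+1 b)) ->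
  (forall a b, S a b -> (0 < a) = (0 < b)) ->
  (forall x y, T x y -> [/\ S x y, Psi x & Psi y]) ->
  (forall x y, T x y -> succ 0 < x -> T (pred_Psi x) (pred_Psi y)) ->
  (forall a b, S a b -> a != 0 -> T (psi a) (psi b)) ->
  (forall a b, S a b -> exists y, T (succ a) y) ->
  good S /\ forall x y, S x y -> Psi x -> Psi y -> T x y.
Proof.
move=> S0 SB Sdiv Spos TS Tpred Spsi Ssucc.
have Ss a b : S a b -> T (succ a) (succ b).
  move=> hab; have [y hy] := Ssucc _ _ hab; have [hS h1 h2] := TS _ _ hy.
  have hB := SB _ _ _ _ hab hS; have [_ n1 e1] := succP HT a.
  have := Spsi _ _ hB n1; rewrite e1 => ht.
  have [hS' _ _] := TS _ _ ht.
  have ey : psi (b - y) = y by apply: (sub_fun SB Spos hS' hS).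
  rewrite (@succ_eq _ _ HT b y) //.
  by rewrite -(sub_eq0 S0 SB Spos hB).
have ST x y : S x y -> Psi x -> Psi y -> T x y.
  move=> h hx hy; have := Tpred _ _ (Ss _ _ h).
  rewrite (pred_eq HT hx erefl) (pred_eq HT hy erefl); apply.
  by apply: le_lt_trans (T0_s0_least HT hx) _; exact: lt_succ.
split=> //; split=> //.
- by move=> a b h1 h2; have [] := TS _ _ (Spsi _ _ h1 h2).
- by move=> a b h1; have [] := TS _ _ (Ss _ _ h1).
- by move=> a b h1 h2 h3 h4; have [] := TS _ _ (Tpred _ _ (ST _ _ h1 h2 h3) h4).
Qed.

Section GoodFacts.
Variable S : G -> G -> Prop.
Hypothesis gS : good S.

Definition goodN := subN (good0 gS) (goodB gS).
Definition goodD := subD (good0 gS) (goodB gS).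
Definition goodMz := subMz (good0 gS) (goodB gS).
Definition good_lt := sub_lt (goodB gS) (good_pos gS).
Definition good_le := sub_le (goodB gS) (good_pos gS).
Definition good_eq0 := sub_eq0 (good0 gS) (goodB gS) (good_pos gS).
Definition good_fun := sub_fun (goodB gS) (good_pos gS).
Definition good_inj := sub_inj (goodB gS) (good_pos gS).

Lemma good_s0 : S (succ 0) (succ 0).
Proof. exact: good_succ (good0 gS). Qed.

End GoodFacts.

Lemma good_sym S : good S -> good (fun a b => S b a).
Proof.
move=> gS; split.
- exact: good0.
- by move=> a b c d; exact: goodB.
- by move=> n a b; exact: good_div.
- by move=> a b h; rewrite (good_pos gS h).
- by move=> a b h n0; apply: good_psi; rewrite // (good_eq0 gS h).
- by move=> a b; exact: good_succ.
- move=> a b h h1 h2 h3; apply: good_pred => //.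
  by rewrite (good_lt gS (good_s0 gS) h).
Qed.

(** Membership in [Psi] is recognized by [s] and [p]: from [a = p (s a)] follows [b = p (s b)], and
    a predecessor lies in [Psi]. *)
Lemma good_Psi_imp S a b : good S -> S a b -> Psi a -> Psi b.
Proof.
move=> gS h ha; have ls : succ 0 < succ a.
  by apply: le_lt_trans (T0_s0_least HT ha) _; exact: lt_succ.
have [ps _ _] := succP HT a; have [ps' _ _] := succP HT b.
have hs := good_succ gS h.
have := good_pred gS hs ps ps' ls.
rewrite (pred_eq HT ha erefl) => /(good_fun gS h) ->.
by have [] := predP HT ps'; rewrite // -(good_lt gS (good_s0 gS) hs).
Qed.

Lemma good_Psi S a b : good S -> S a b -> Psi a <-> Psi b.
Proof.
move=> gS h; split; first exact: (good_Psi_imp gS h).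
exact: (good_Psi_imp (good_sym gS) h).
Qed.

Definition opt_rel S (o o' : option G) : Prop :=
  match o, o' with
  | Some a, Some b => S a b
  | None, None => True
  | _, _ => False
  end.

Lemma eval_opt_rel S (V : Type) (t : term L_log V) (e e' : V -> log_structure psi) :
  good S -> (forall v, tvars t v -> opt_rel S (e v) (e' v)) ->
  opt_rel S (eval e t) (eval e' t).
Proof.
move=> gS; elim: t => [v|F ts IH] he /=; first exact: he.
have {}IH i : opt_rel S (eval e (ts i)) (eval e' (ts i)).
  by apply: IH => v hv; apply: he; exists i.
case: F ts IH {he} => [||||||| n] ts IH /=; rewrite /log_fint.
- exact: good0.
- have := IH ord0; have := IH ord_max.
  case: (eval e (ts ord_max)) (eval e' (ts ord_max)) => [a|] [b|] //=.
    case: (eval e (ts ord0)) (eval e' (ts ord0)) => [c|] [d|] //=.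
    by move=> h1 h2; exact: goodD.
  by case: (eval e (ts ord0)) (eval e' (ts ord0)) => [c|] [d|].
- have := IH ord0.
  by case: (eval e (ts ord0)) (eval e' (ts ord0)) => [c|] [d|] //=; exact: goodN.
- have := IH ord0.
  case: (eval e (ts ord0)) (eval e' (ts ord0)) => [c|] [d|] //= h.
  by rewrite -(good_eq0 gS h); case: eqVneq => //= n0; exact: good_psi.
- by [].
- have := IH ord0.
  by case: (eval e (ts ord0)) (eval e' (ts ord0)) => [c|] [d|] //=; exact: good_succ.
- have := IH ord0.
  case: (eval e (ts ord0)) (eval e' (ts ord0)) => [c|] [d|] //= h.
  have hi : Psi_gt_s0 psi c <-> Psi_gt_s0 psi d.
    rewrite /Psi_gt_s0 /= /setI /= (good_lt gS (good_s0 gS) h).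
    by have := good_Psi gS h; tauto.
  case: ifPn; rewrite ?(inE, notin_setE) => hc; case: ifPn; rewrite ?(inE, notin_setE).
  + by move: hc => [h1 h2] [h3 _]; exact: good_pred.
  + by move=> hd; apply: hd; apply/hi.
  + by move=> hd; apply: hc; apply/hi.
  + by [].
- have := IH ord0.
  by case: (eval e (ts ord0)) (eval e' (ts ord0)) => [c|] [d|] //=; exact: good_div.
Qed.

Lemma back_and_forth (K : (G -> G -> Prop) -> Prop) :
  (forall S, K S -> good S) ->
  (forall S a, K S -> exists S' b,
     [/\ K S', (forall c d, S c d -> S' c d) & S' a b]) ->
  (forall S b, K S -> exists S' a,
     [/\ K S', (forall c d, S c d -> S' c d) & S' a b]) ->
  forall (V : Type) (phi : formula L_log V) S (e e' : V -> log_structure psi),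
    K S -> (forall v, fvars phi v -> opt_rel S (e v) (e' v)) ->
    sat phi e <-> sat phi e'.
Proof.
move=> Kgood forth back V phi; elim: phi => {V} [V|V t u|V P ts|V p IHp q IHq|V p IHp] S e e' KS he /=.
- by [].
- have gS := Kgood _ KS.
  have := eval_opt_rel gS (fun v hv => he v (or_introl hv)).
  have := eval_opt_rel gS (fun v hv => he v (or_intror hv)).
  case: (eval e t) (eval e' t) => [a|] [b|] //=;
    case: (eval e u) (eval e' u) => [c|] [d|] //= h1 h2.
  split=> -[E]; congr Some; move: h1 h2.
    by rewrite E => h1 h2; apply: (good_fun gS h2 h1).
  by rewrite E => h1 h2; apply: (good_inj gS h2 h1).
- have gS := Kgood _ KS; case: P ts he => ts he.
  have {he} he i := eval_opt_rel gS (fun v hv => he v (ex_intro2 _ _ i I hv)).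
  have := he ord0; have := he ord_max.
  case: (eval e (ts ord0)) (eval e' (ts ord0)) => [a|] [b|] //=;
    case: (eval e (ts ord_max)) (eval e' (ts ord_max)) => [c|] [d|] //= h1 h2.
  by rewrite (good_lt gS h2 h1).
- have h1 := IHp _ _ _ KS (fun v hv => he v (or_introl hv)).
  have h2 := IHq _ _ _ KS (fun v hv => he v (or_intror hv)).
  by tauto.
- have ext S' (o o' : option G) : K S' -> (forall c d, S c d -> S' c d) ->
      opt_rel S' o o' -> forall v, fvars p v ->
      opt_rel S' (match v with Some x => e x | None => o end)
                 (match v with Some x => e' x | None => o' end).
    move=> KS' sub ho [v|] // /(he v).
    by case: (e v) (e' v) => [a|] [b|] //=; exact: sub.
  split=> h [b|].
  + have [S' [a [KS' sub hab]]] := back S b KS.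
    by apply/(IHp _ _ _ KS' (ext _ (Some a) (Some b) KS' sub hab)); exact: h.
  (* Infinity is answered by infinity, without extending [S]. *)
  + by apply/(IHp _ _ _ KS (ext _ None None KS (fun c d => id) I)); exact: h.
  + have [S' [a [KS' sub hab]]] := forth S b KS.
    by apply/(IHp _ _ _ KS' (ext _ (Some b) (Some a) KS' sub hab)); exact: h.
  + by apply/(IHp _ _ _ KS (ext _ None None KS (fun c d => id) I)); exact: h.
Qed.

End PartialIsomorphisms.

(** * Adjoining an element of Psi *)

Section ClosedSets.
Variables (G : orderedZmodType) (psi : G -> G).

(** Closure is asked for at the default arguments too, so that it carries no side conditions. *)
Definition closed_sub (H : set G) :=
  [/\ forall a b, H a -> H b -> H (a - b), forall n a, H a -> H (div_by n.+1 a),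
      forall a, H a -> H (psi a), forall a, H a -> H (succ psi a) &
      forall a, H a -> H (pred_Psi psi a)].

Variable H : set G.
Hypothesis cH : closed_sub H.

Lemma closedN a : H a -> H (- a).
Proof. by case: cH => HB _ _ _ _ ha; rewrite -sub0r; apply: (HB _ _ _ ha); rewrite -(subrr a); exact: HB. Qed.

Lemma closedD a b : H a -> H b -> H (a + b).
Proof. by case: cH => HB _ _ _ _ ha hb; rewrite -[b]opprK; apply/HB/closedN. Qed.

Lemma closedMz a (m : int) : H a -> H (a *~ m).
Proof.
move=> ha; have hn n : H (a *+ n).
  elim: n => [|n IH]; last by rewrite mulrS; exact: closedD.
  by rewrite mulr0n -(subrr a); case: cH => HB _ _ _ _; exact: HB.
case: m => n; first by rewrite -pmulrn.
by rewrite NegzE mulrNz -pmulrn; exact: closedN.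
Qed.

Lemma closed_divz a (m : int) : m != 0 -> H (a *~ m) -> H a.
Proof.
case: cH => _ Hd _ _ _; have key n : H (a *+ n.+1) -> H a.
  move=> /(Hd n); have -> // : div_by n.+1 (a *+ n.+1) = a.
  have : [set b | b *+ n.+1 = a *+ n.+1] (div_by n.+1 (a *+ n.+1)).
    by apply: xgetPex; exists a.
  exact: og_muln_inj.
case: m => [[//|n]|n] _; first by rewrite -pmulrn; exact: key.
by rewrite NegzE mulrNz -pmulrn => /closedN; rewrite opprK; exact: key.
Qed.

End ClosedSets.

Section GalaxyExtension.
Variables (G : orderedZmodType) (psi : G -> G).
Hypothesis HT : model_T0 psi.
Implicit Types (a b c d g h l u w x y z : G).

Local Notation Psi := (Psi psi).
Local Notation succ := (succ psi).
Local Notation pred_Psi := (pred_Psi psi).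

Lemma pos_mulz u (c : int) : u != 0 -> c != 0 ->
  (0 < u *~ c) = ((0 < u) == (0 < c)).
Proof.
move=> nu; case: c => [[//|n]|n] _; first by rewrite -pmulrn og_muln_pos eqb_id.
rewrite NegzE mulrNz -pmulrn og_oppr_gt0 -(@og_muln_pos _ u n).
have ne : u *+ n.+1 != 0 by rewrite pmulrn og_mulz_eq0.
have -> : (0 < - n.+1%:Z) = false by [].
case: (og_cases (u *+ n.+1)) => h; first by rewrite h (lt_gtF h).
  by rewrite h eqxx in ne.
by rewrite h (lt_gtF h).
Qed.

Lemma iter_Psi i l : Psi l -> Psi (iter i succ l).
Proof. by move=> hl; elim: i => //= i; apply: Psi_succ. Qed.

Lemma iter_le i l : Psi l -> l <= iter i succ l.
Proof.
move=> hl; elim: i => //= i IH; apply: (le_trans IH).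
by apply/ltW/(lt_succ HT)/iter_Psi.
Qed.

Lemma iter_lt i j l : Psi l -> (iter i succ l < iter j succ l) = (i < j)%N.
Proof.
move=> hl; case: (ltnP i j) => hij; last first.
  apply/negbTE; rewrite -og_leNgt -(subnK hij) iterD.
  exact/iter_le/iter_Psi.
rewrite -(subnK hij) iterD.
apply: lt_le_trans (iter_le _ _); last exact: iter_Psi.
exact/(lt_succ HT)/iter_Psi.
Qed.

Lemma iter_inj i g h : Psi g -> Psi h -> iter i succ g = iter i succ h -> g = h.
Proof.
move=> hg hh; elim: i => //= i IH e; apply: IH.
by apply: succ_inj HT _ _ _ _ e; apply: iter_Psi.
Qed.

Variable S : G -> G -> Prop.
Hypothesis gS : good psi S.
Variables x y : G.
Hypotheses (hx : Psi x) (hy : Psi y).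

(** Both alternatives are strict, so this also says that [g] avoids the [Psi]-part of the domain and
    [h] its image. *)
Definition same_cut g h := forall a b, S a b -> Psi a ->
  (a < g /\ b < h) \/ (g < a /\ h < b).
Hypothesis cut : same_cut x y.

(** The galaxy of [x] paired with that of [y]: [g] and [h] stand for [s^(j-i) x] and [s^(j-i) y],
    two exponents replacing a possibly negative one. *)
Definition gal g h := [/\ Psi g, Psi h & exists i j,
  iter i succ g = iter j succ x /\ iter i succ h = iter j succ y].

(** An element [a] of the domain could separate [g] from [s g] only by being [s g]; then [p a = g]
    would lie in the domain, which a strict cut excludes. *)
Lemma same_cutS g h : Psi g -> Psi h ->
  same_cut (succ g) (succ h) <-> same_cut g h.
Proof.
move=> hg hh; split=> hc a b hab ha; have hb := good_Psi_imp HT gS hab ha.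
  have := hc _ _ (good_succ gS hab) (Psi_succ HT ha).
  by rewrite !succ_lt.
case: (hc _ _ hab ha) => -[h1 h2].
  by left; split; [apply: lt_trans h1 _|apply: lt_trans h2 _]; apply: lt_succ.
have s0 : succ 0 < a by apply: le_lt_trans h1; exact: T0_s0_least.
right; split; rewrite lt_neqAle succ_le // ?h1 ?h2 andbT; apply/eqP => e;
  have := hc _ _ (good_pred gS hab ha hb s0).
  rewrite -e (pred_eq HT hg erefl) => /(_ hg).
  by rewrite ltxx => -[[]|[]].
have [p1 _] := predP HT ha s0; move=> /(_ p1).
by rewrite -e (pred_eq HT hh erefl) ltxx => -[[]|[]].
Qed.

Lemma gal_cut g h : gal g h -> same_cut g h.
Proof.
case=> hg hh [i [j [e1 e2]]].
have : same_cut (iter j succ x) (iter j succ y).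
  by elim: j {e1 e2} => //= k IH; apply/same_cutS => //; apply: iter_Psi.
rewrite -e1 -e2; elim: i {e1 e2} => //= k IH hk.
by apply: IH; apply/same_cutS => //; apply: iter_Psi.
Qed.

Lemma gal_refl : gal x y.
Proof. by split=> //; exists 0%N, 0%N. Qed.

Lemma gal_succ g h : gal g h -> gal (succ g) (succ h).
Proof.
case=> hg hh [i [j [e1 e2]]]; split; [exact: Psi_succ|exact: Psi_succ|].
by exists i, j.+1; rewrite -!iterSr !iterS e1 e2.
Qed.

Lemma gal_iter k g h : gal g h -> gal (iter k succ g) (iter k succ h).
Proof. by move=> hg; elim: k => //= k; exact: gal_succ. Qed.

(** [s 0] lies in the domain and is least in [Psi], so a galaxy avoiding the domain is above it and
    [p] stays inside the galaxy. *)
Lemma gal_gt_s0 g h : gal g h -> succ 0 < g /\ succ 0 < h.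
Proof.
move=> hg; have [hg1 _ _] := hg.
case: (gal_cut hg (good_s0 gS) (T0_s0_Psi HT)) => -[] //.
by rewrite og_ltNge (T0_s0_least HT).
Qed.

Lemma gal_pred g h : gal g h -> gal (pred_Psi g) (pred_Psi h).
Proof.
move=> hgal; have [l1 l2] := gal_gt_s0 hgal; case: hgal => hg hh [i [j [e1 e2]]].
have [p1 q1] := predP HT hg l1; have [p2 q2] := predP HT hh l2.
by split=> //; exists i.+1, j; rewrite !iterSr q1 q2.
Qed.

Lemma gal_base g h g' h' : gal g h -> gal g' h' -> exists l l' i j,
  gal l l' /\ (g = iter i succ l /\ h = iter i succ l') /\
  (g' = iter j succ l /\ h' = iter j succ l').
Proof.
move=> h1 h2; have [hg hh [i [j [e1 e2]]]] := h1.
have [hg' hh' [i' [j' [e1' e2']]]] := h2.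
have E1 : iter (j' + i) succ g = iter (j + i') succ g'.
  by rewrite !iterD e1 e1' -!iterD addnC.
have E2 : iter (j' + i) succ h = iter (j + i') succ h'.
  by rewrite !iterD e2 e2' -!iterD addnC.
move: (j' + i)%N (j + i')%N E1 E2 => p q E1 E2.
case: (leqP p q) => hpq.
  exists g', h', (q - p)%N, 0%N; do 2!split=> //.
  by split; apply: (@iter_inj p); rewrite -?iterD ?subnKC //; apply: iter_Psi.
move/ltnW in hpq.
exists g, h, 0%N, (p - q)%N; do 2!split=> //.
by split; apply: (@iter_inj q); rewrite -?iterD ?subnKC //; apply: iter_Psi.
Qed.

Lemma gal_lt g h g' h' : gal g h -> gal g' h' -> (g < g') = (h < h').
Proof.
move=> h1 h2; have [l [l' [i [j [[pl pl' _] [[-> ->] [-> ->]]]]]]] := gal_base h1 h2.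
by rewrite !iter_lt.
Qed.

Lemma gal_side g h g' h' a b : gal g h -> gal g' h' -> S a b -> Psi a ->
  a < g -> a < g'.
Proof.
move=> h1 h2 hab ha.
have [l [l' [i [j [hl [[-> _] [-> _]]]]]]] := gal_base h1 h2.
have [pl pl' _] := hl.
have key k : (a < iter k succ l) = (a < l).
  elim: k => //= k <-; rewrite lt_succ_le //; last exact: iter_Psi.
  rewrite le_eqVlt; case: eqP => //= e.
  have := gal_iter k hl.
  by move=> /gal_cut /(_ _ _ hab ha); rewrite -e ltxx => -[[]|[]].
by rewrite !key.
Qed.

Definition psi_pair g h := [/\ S g h, Psi g & Psi h] \/ gal g h.

Lemma psi_pair_lt g h g' h' : psi_pair g h -> psi_pair g' h' -> (g < g') = (h < h').
Proof.
move=> [[h1 p1 p2]|h1] [[h2 q1 q2]|h2]; last exact: (gal_lt h1 h2).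
- exact: (good_lt gS h1 h2).
- by case: (gal_cut h2 h1 p1) => -[l1 l2]; rewrite ?l1 ?l2 ?(lt_gtF l1) ?(lt_gtF l2).
- by case: (gal_cut h1 h2 q1) => -[l1 l2]; rewrite ?l1 ?l2 ?(lt_gtF l1) ?(lt_gtF l2).
Qed.

Lemma psi_pair_Psi g h : psi_pair g h -> Psi g /\ Psi h.
Proof. by case=> -[]. Qed.

Lemma psi_pair_succ g h : psi_pair g h -> psi_pair (succ g) (succ h).
Proof.
case=> [[h1 p q]|h1]; last by right; exact: gal_succ.
by left; split; [exact: good_succ|exact: Psi_succ|exact: Psi_succ].
Qed.

Lemma psi_pair_pred g h : psi_pair g h -> succ 0 < g ->
  psi_pair (pred_Psi g) (pred_Psi h).
Proof.
case=> [[h1 p q]|h1] l1; last by right; exact: gal_pred.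
have l2 : succ 0 < h by rewrite -(good_lt gS (good_s0 gS) h1).
left; split; [exact: good_pred| |].
  by have [] := predP HT p l1.
by have [] := predP HT q l2.
Qed.

(** What must be preserved by an isomorphism: vanishing, sign, and the value up to [psi_pair].
    Cancellation can destroy it under addition; [simD] needs distinct values, and the normal forms
    below serve to produce such sums. *)
Definition sim u u' := (u = 0 /\ u' = 0) \/
  [/\ u != 0, u' != 0, psi_pair (psi u) (psi u') & (0 < u) = (0 < u')].

Lemma sim_mulz u u' (c : int) : sim u u' -> c != 0 -> sim (u *~ c) (u' *~ c).
Proof.
case=> [[-> ->]|[n1 n2 h e]] hc; first by left; rewrite !mul0rz.
by right; rewrite !og_mulz_eq0 // !psi_mulz // !pos_mulz // e.
Qed.

Lemma sim_mulz_inv u u' (c : int) : c != 0 -> sim (u *~ c) (u' *~ c) -> sim u u'.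
Proof.
move=> hc; have z (v : G) : (v *~ c == 0) = (v == 0).
  case: (eqVneq v 0) => [->|nv]; first by rewrite mul0rz eqxx.
  by apply/negbTE/og_mulz_eq0.
case=> [[/eqP e1 /eqP e2]|]; first by left; rewrite z in e1; rewrite z in e2; split; apply/eqP.
rewrite !z !psi_mulz // => -[n1 n2 h]; rewrite !pos_mulz // => e.
by right; split=> //; move: e; case: (0 < u); case: (0 < u'); case: (0 < c).
Qed.

Lemma sim_small r r' k k' : sim r r' -> psi_pair k k' -> small psi r k ->
  small psi r' k'.
Proof.
case=> [[_ ->]|[n1 n2 h _]] hk hs; first by rewrite /small eqxx.
by move=> _; rewrite -(psi_pair_lt hk h); apply: hs.
Qed.

Lemma sim_dom d d' r r' : sim d d' -> d != 0 ->
  small psi r (psi d) -> small psi r' (psi d') -> sim (d + r) (d' + r').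
Proof.
case=> [[-> _]|[n1 n2 h e]]; rewrite ?eqxx // => _ s1 s2.
have [a1 a2 a3] := small_dom HT n1 s1; have [b1 b2 b3] := small_dom HT n2 s2.
by right; rewrite a1 b1 a2 b2 a3 b3.
Qed.

Lemma simD d d' r r' : sim d d' -> sim r r' -> (r != 0 -> psi d != psi r) ->
  sim (d + r) (d' + r').
Proof.
move=> h1 h2 ne.
case: (h1) => [[-> ->]|[n1 m1 p1 e1]]; first by rewrite !add0r.
case: (h2) => [[-> ->]|[n2 m2 p2 e2]]; first by rewrite !addr0.
have {}ne := ne n2; case/orP: (og_total (psi d) (psi r)) => hle.
  have s : small psi r (psi d) by move=> _; rewrite lt_neqAle ne.
  by apply: sim_dom => //; apply: sim_small s.
have s : small psi d (psi r) by move=> _; rewrite lt_neqAle eq_sym ne.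
by rewrite addrC [d' + _]addrC; apply: sim_dom => //; apply: sim_small s.
Qed.

Lemma good_sim a b : S a b -> sim a b.
Proof.
move=> h; case: (eqVneq a 0) => [e|n0].
  by left; split=> //; apply/eqP; rewrite -(good_eq0 gS h) e.
have n0' : b != 0 by rewrite -(good_eq0 gS h).
right; split=> //; last exact: (good_pos gS h).
by left; split; [exact: (good_psi gS h)|exact: psi_Psi|exact: psi_Psi].
Qed.

Lemma gal_neq g h a b : gal g h -> S a b -> Psi a -> a != g.
Proof.
by move=> /gal_cut hc hab /(hc _ _ hab) [[]|[]] hl _; rewrite ?(lt_eqF hl) ?(gt_eqF hl).
Qed.

(* Integer combinations of the differences [s^(j+1) l - s^j l]. *)
Inductive gcomb : G -> G -> G -> G -> Prop :=
| gcomb0 l l' : gcomb l l' 0 0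
| gcombS (c : int) l l' w w' : gcomb (succ l) (succ l') w w' ->
    gcomb l l' ((succ l - l) *~ c + w) ((succ l' - l') *~ c + w').

Lemma gcombB l l' w w' v v' : gcomb l l' w w' -> gcomb l l' v v' ->
  gcomb l l' (w - v) (w' - v').
Proof.
move=> h; elim: h v v' => {l l' w w'} [l l'|c l l' w w' hw IH] v v' hv.
  rewrite !sub0r; elim: hv => {l l' v v'} [l l'|c l l' v v' _ IH].
    by rewrite oppr0; constructor.
  by rewrite !opprD -!mulrNz; constructor.
case: l l' v v' / hv IH hw => [l l'|c' l l' v v' hv] IH hw.
  by rewrite !subr0; constructor.
have -> : (succ l - l) *~ c + w - ((succ l - l) *~ c' + v) =
    (succ l - l) *~ (c - c') + (w - v) by zlin.
have -> : (succ l' - l') *~ c + w' - ((succ l' - l') *~ c' + v') =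
    (succ l' - l') *~ (c - c') + (w' - v') by zlin.
by constructor; apply: IH.
Qed.

Lemma gcombMz l l' w w' (m : int) : gcomb l l' w w' -> gcomb l l' (w *~ m) (w' *~ m).
Proof.
elim=> {l l' w w'} [l l'|c l l' w w' _ IH]; first by rewrite !mul0rz; constructor.
have -> : ((succ l - l) *~ c + w) *~ m = (succ l - l) *~ (c * m) + w *~ m by zlin.
have -> : ((succ l' - l') *~ c + w') *~ m = (succ l' - l') *~ (c * m) + w' *~ m by zlin.
by constructor.
Qed.

(** [s^i l - l] telescopes into consecutive differences, so passing from [R s^i l] to [R l] only
    alters the combination. Two normal forms can thus be brought to a common [l] and subtracted. *)
Lemma gcomb_rebase i (R : int) l l' w w' :
  gcomb (iter i succ l) (iter i succ l') w w' ->
  gcomb l l' ((iter i succ l - l) *~ R + w) ((iter i succ l' - l') *~ R + w').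
Proof.
elim: i w w' => [|i IH] w w'; first by rewrite /= !subrr !mul0rz !add0r.
rewrite !iterS => /(gcombS R) /IH.
have e (k m v : G) : (k - m) *~ R + ((succ k - k) *~ R + v) = (succ k - m) *~ R + v.
  by zlin.
by rewrite !e.
Qed.

Definition gsim l w w' := (w = 0 /\ w' = 0) \/
  [/\ w != 0, w' != 0, gal (psi w) (psi w'), l < psi w & (0 < w) = (0 < w')].

Lemma gsim_sim l w w' : gsim l w w' -> sim w w'.
Proof. by case=> [|[h1 h2 h3 h4 h5]]; [left|right; split=> //; right]. Qed.

Lemma gsim_small l w w' : gsim l w w' -> small psi w l.
Proof. by case=> [[-> _]|[]]; rewrite /small ?eqxx. Qed.

(** The leading difference has value [s l] and [w] a larger one: the first nonzero coefficient of a
    combination decides its value and its sign. *)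
Lemma gsim_step l l' (c : int) w w' : gal l l' -> gsim (succ l) w w' ->
  gsim l ((succ l - l) *~ c + w) ((succ l' - l') *~ c + w') /\
  (c != 0 -> psi ((succ l - l) *~ c + w) = succ l /\ (succ l - l) *~ c + w != 0).
Proof.
move=> hl hw; have [pl pl' _] := hl; have ls := lt_succ HT pl.
case: (eqVneq c 0) => [->|nc].
  split=> //; rewrite !mulr0z !add0r.
  case: hw => [|[h1 h2 h3 h4 h5]]; [by left|right; split=> //].
  exact: lt_trans h4.
have e1 : psi ((succ l - l) *~ c) = succ l.
  by rewrite psi_mulz // psi_PsiB //; apply: Psi_succ.
have e2 : psi ((succ l' - l') *~ c) = succ l'.
  by rewrite psi_mulz // psi_PsiB ?lt_succ //; apply: Psi_succ.
have p1 : 0 < succ l - l by rewrite og_subr_gt0.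
have p2 : 0 < succ l' - l' by rewrite og_subr_gt0 lt_succ.
have s1 : small psi w (psi ((succ l - l) *~ c)) by rewrite e1; exact: gsim_small hw.
have s2 : small psi w' (psi ((succ l' - l') *~ c)).
  rewrite e2; apply: sim_small (gsim_sim hw) _ _; last exact: gsim_small hw.
  by right; exact: gal_succ.
have n1 := og_mulz_eq0 (og_gt0_neq0 p1) nc.
have n2 := og_mulz_eq0 (og_gt0_neq0 p2) nc.
have [a1 a2 a3] := small_dom HT n1 s1; have [b1 b2 b3] := small_dom HT n2 s2.
split; last by rewrite a2 e1.
right; rewrite a1 b1 a2 b2 a3 b3 e1 e2; split=> //; first exact: gal_succ.
by rewrite !pos_mulz ?og_gt0_neq0 // p1 p2.
Qed.

Lemma gcomb_gsim l l' w w' : gcomb l l' w w' -> gal l l' -> gsim l w w'.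
Proof.
elim=> {l l' w w'} [l l'|c l l' w w' _ IH] hl; first by left.
by have [] := gsim_step c hl (IH (gal_succ hl)).
Qed.

(** Expanding [z - l] along consecutive differences lowers each coefficient of [w] by [R]. When the
    terms of [w] end, at [k] say, [- R (z - k)] remains, with value [s k]; so the result is nonzero
    and its value stays in the galaxy. *)
Lemma gcomb_far l l' w w' z z' (R : int) : gcomb l l' w w' -> gal l l' ->
  S z z' -> Psi z -> l < z -> R != 0 ->
  gsim l (w - (z - l) *~ R) (w' - (z' - l') *~ R) /\ w - (z - l) *~ R != 0.
Proof.
move=> hw hl hz pz hlt nR.
elim: hw hl hlt => {l l' w w'} [l l'|c l l' w w' hw IH] hl hlt.
  have [pl pl' _] := hl; have pz' := good_Psi_imp HT gS hz pz.
  have hlt' : l' < z'.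
    by case: (gal_cut hl hz pz) => -[] // h; rewrite (lt_gtF h) in hlt.
  have nR' : - R != 0 by rewrite oppr_eq0.
  have p1 : 0 < z - l by rewrite og_subr_gt0.
  have p2 : 0 < z' - l' by rewrite og_subr_gt0.
  have n1 := og_mulz_eq0 (og_gt0_neq0 p1) nR'.
  have n2 := og_mulz_eq0 (og_gt0_neq0 p2) nR'.
  rewrite !sub0r -!mulrNz; split=> //.
  right; rewrite n1 n2 !psi_mulz // !psi_PsiB //; split=> //.
  - exact: gal_succ.
  - exact: lt_succ.
  - by rewrite !pos_mulz ?og_gt0_neq0 // p1 p2.
have hl' := gal_succ hl; have [pl pl' _] := hl.
have hltS : succ l < z.
  have := gal_neq hl' hz pz; rewrite lt_neqAle eq_sym => ->.
  by rewrite succ_le.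
have [h1 h2] := IH hl' hltS.
have -> : (succ l - l) *~ c + w - (z - l) *~ R =
   (succ l - l) *~ (c - R) + (w - (z - succ l) *~ R) by zlin.
have -> : (succ l' - l') *~ c + w' - (z' - l') *~ R =
   (succ l' - l') *~ (c - R) + (w' - (z' - succ l') *~ R) by zlin.
have [h3 h4] := gsim_step (c - R) hl h1; split=> //.
case: (eqVneq (c - R) 0) => [->|/h4[]//].
by rewrite mulr0z add0r.
Qed.

(** [h] is the point where the terms of [w] end: only differences below [h] remain after the
    subtraction, and their values are at most [h]. *)
Lemma gcomb_top l l' w w' (R : int) : gcomb l l' w w' -> gal l l' ->
  exists h h', [/\ gal h h', l <= h, gsim l (w - (h - l) *~ R) (w' - (h' - l') *~ R) &
    w - (h - l) *~ R != 0 -> psi (w - (h - l) *~ R) <= h].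
Proof.
elim=> {l l' w w'} [l l'|c l l' w w' _ IH] hl.
  exists l, l'; rewrite !subrr !mul0rz subr0; split=> //; first by left.
  by rewrite eqxx.
have hl' := gal_succ hl; have [h [h' [hh hle hs hp]]] := IH hl'.
have [pl pl' _] := hl.
exists h, h'.
have -> : (succ l - l) *~ c + w - (h - l) *~ R =
   (succ l - l) *~ (c - R) + (w - (h - succ l) *~ R) by zlin.
have -> : (succ l' - l') *~ c + w' - (h' - l') *~ R =
   (succ l' - l') *~ (c - R) + (w' - (h' - succ l') *~ R) by zlin.
have [h3 h4] := gsim_step (c - R) hl hs; split=> //.
  by apply: le_trans hle; apply/ltW/lt_succ.
case: (eqVneq (c - R) 0) => [->|/h4[-> _]//].
by rewrite mulr0z add0r.
Qed.

Lemma good_divz a b (R : int) : S a b -> R != 0 ->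
  exists a2 b2, [/\ S a2 b2, a2 *~ R = a & b2 *~ R = b].
Proof.
move=> h; case: R => [[//|n]|n] _.
  by exists (div_by n.+1 a), (div_by n.+1 b); rewrite -!pmulrn !(div_byK HT) //; split=> //; exact: (good_div gS _ h).
exists (- div_by n.+1 a), (- div_by n.+1 b); rewrite NegzE !mulrNz !mulNrz !opprK -!pmulrn.
by rewrite !(div_byK HT) //; split=> //; apply: (goodN gS); exact: (good_div gS _ h).
Qed.

(* Up to a nonzero integer factor, an element of the substructure generated by
   the domain of [S] and [x] is [a + R l + w], where [l] is an iterated
   predecessor of [x] and [w] a combination of differences of consecutive
   iterated successors of [l]. *)
Definition galaxy_ext u u' := exists (N : int) a b (R : int) l l' w w',
  [/\ N != 0, S a b, gal l l' & gcomb l l' w w'] /\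
  (u *~ N = a + l *~ R + w /\ u' *~ N = b + l' *~ R + w').

Local Notation S' := galaxy_ext.

Lemma galaxy_ext_sub a b : S a b -> S' a b.
Proof.
move=> h; exists 1, a, b, 0, x, y, 0, 0; rewrite !mulr0z !addr0 !mulr1z.
by do 2!split=> //; [exact: gal_refl|constructor].
Qed.

Lemma galaxy_ext_gal g h : gal g h -> S' g h.
Proof.
move=> hg; exists 1, 0, 0, 1, g, h, 0, 0; rewrite !mulr1z !addr0 !add0r.
by do 2!split=> //; [exact: good0 gS|constructor].
Qed.

Lemma galaxy_ext_pair g h : psi_pair g h -> S' g h.
Proof. by case=> [[h1 _ _]|]; [exact: galaxy_ext_sub|exact: galaxy_ext_gal]. Qed.

Lemma galaxy_extB u u' v v' : S' u u' -> S' v v' -> S' (u - v) (u' - v').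
Proof.
move=> [N1 [a1 [b1 [R1 [l1 [l1' [w1 [w1' [[nN1 ha1 hl1 hw1] [e1 e1']]]]]]]]]].
move=> [N2 [a2 [b2 [R2 [l2 [l2' [w2 [w2' [[nN2 ha2 hl2 hw2] [e2 e2']]]]]]]]]].
have [l [l' [i [j [hl [[E1 E1'] [E2 E2']]]]]]] := gal_base hl1 hl2.
rewrite E1 E1' in hw1; rewrite E2 E2' in hw2.
have {}hw1 := gcombMz N2 (gcomb_rebase R1 hw1).
have {}hw2 := gcombMz N1 (gcomb_rebase R2 hw2).
have hw := gcombB hw1 hw2; rewrite -E1 -E1' -E2 -E2' in hw.
exists (N1 * N2), (a1 *~ N2 - a2 *~ N1), (b1 *~ N2 - b2 *~ N1),
  (R1 * N2 - R2 * N1), l, l'; do 2!eexists; split; first split; [| |exact: hl|exact: hw|].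
- by rewrite mulf_neq0.
- by apply: (goodB gS); apply: (goodMz gS).
have e k m : (k - m) *~ (N1 * N2) = (k *~ N1) *~ N2 - (m *~ N2) *~ N1 by zlin.
by rewrite !e e1 e1' e2 e2'; split; zlin.
Qed.

Lemma galaxy_ext_div n u u' : S' u u' -> S' (div_by n.+1 u) (div_by n.+1 u').
Proof.
move=> [N [a [b [R [l [l' [w [w' [[nN ha hl hw] [e e']]]]]]]]]].
exists (n.+1%:Z * N), a, b, R, l, l', w, w'; split; first by split=> //; rewrite mulf_neq0.
by rewrite !mulrzA -!pmulrn !(div_byK HT).
Qed.

(* For [R != 0] put [z = s (- a / R)]; then
   [a + R l + w = R (a / R + z) + (w - R (z - l))], where the first summand has
   value [z] and the second one [s z] if [z < l], and a value among the iterated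
   successors of [l] if [z > l]. *)
Lemma galaxy_ext_sim u u' : S' u u' -> sim u u'.
Proof.
move=> [N [a [b [R [l [l' [w [w' [[nN ha hl hw] [e e']]]]]]]]]].
apply: (sim_mulz_inv nN); rewrite e e'.
have gw := gcomb_gsim hw hl; have sw := gsim_sim gw.
have [pl pl' _] := hl.
(* For [R = 0] the value of [a] lies in the domain and that of [w] in the galaxy, so they differ. *)
case: (eqVneq R 0) => [->|nR].
  rewrite !mulr0z !addr0; case: (eqVneq a 0) => [a0|na].
    have -> : b = 0 by apply/eqP; rewrite -(good_eq0 gS ha) a0.
    by rewrite a0 !add0r.
  apply: simD => //; first exact: good_sim.
  move=> nw; case: gw => [[w0]|[_ _ hg _ _]]; first by rewrite w0 eqxx in nw.
  by apply: (gal_neq hg (good_psi gS ha na)); apply: psi_Psi.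
have [a2 [b2 [ha2 ea eb]]] := good_divz (goodN gS ha) nR.
have hz := good_succ gS ha2; set z := succ a2 in hz; set z' := succ b2 in hz.
have [pz n1 e1] := succP HT a2; have [pz' n1' e1'] := succP HT b2.
rewrite -/z in pz n1 e1; rewrite -/z' in pz' n1' e1'.
have hd : sim ((a2 - z) *~ (- R)) ((b2 - z') *~ (- R)).
  by apply: sim_mulz; [apply: good_sim; exact: (goodB gS)|rewrite oppr_eq0].
have nd : (a2 - z) *~ (- R) != 0 by apply: og_mulz_eq0 => //; rewrite oppr_eq0.
have ed : psi ((a2 - z) *~ (- R)) = z by rewrite psi_mulz ?oppr_eq0.
have ed' : psi ((b2 - z') *~ (- R)) = z' by rewrite psi_mulz ?oppr_eq0.
have -> : a + l *~ R + w = (a2 - z) *~ (- R) + (w - (z - l) *~ R).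
  have -> : a = - (a2 *~ R) by rewrite ea opprK.
  by zlin.
have -> : b + l' *~ R + w' = (b2 - z') *~ (- R) + (w' - (z' - l') *~ R).
  have -> : b = - (b2 *~ R) by rewrite eb opprK.
  by zlin.
case: (gal_cut hl hz pz) => -[lt1 lt2].
  apply: sim_dom => //; rewrite ?ed ?ed'.
    apply: (smallB HT); first by apply: (small_le _ (gsim_small gw)); apply: ltW.
    by apply: (smallMz HT) => // _; rewrite (psi_PsiBC HT) // (lt_succ HT).
  apply: (smallB HT).
    apply: (@small_le _ _ _ _ l'); first exact: ltW.
    by apply: (sim_small sw _ (gsim_small gw)); right.
  by apply: (smallMz HT) => // _; rewrite (psi_PsiBC HT) // (lt_succ HT).
have [gr nr] := gcomb_far hw hl hz pz lt1 nR.
apply: simD => //; first exact: gsim_sim gr.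
case: gr => [[r0]|[_ _ hg _ _]]; first by rewrite r0 eqxx in nr.
by move=> _; rewrite ed; apply: (gal_neq hg hz).
Qed.

(* The value [psi (u - h)] for a known [h] in [Psi] yields [s u] unless it is
   [s h]; an [h] for which this does not happen is [l], or the place [s a'] of
   a rational multiple [a'] of [a], or lies beyond all terms of [w]. *)
Lemma galaxy_ext_succ u u' : S' u u' -> exists v, psi_pair (succ u) v.
Proof.
(* If [s u] has no partner, then [psi (u - h) = s h] for every available [h]; a contradiction needs
   one [h] where this fails. *)
move=> hu; apply: contrapT => /forallNP hno.
have bad h h' : psi_pair h h' -> u != h /\ psi (u - h) = succ h.
  move=> hh; have [ph _] := psi_pair_Psi hh.
  case: (eqVneq u h) => [e|ne].
    by case: (hno (succ h')); rewrite e; exact: psi_pair_succ.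
  split=> //; case: (galaxy_ext_sim (galaxy_extB hu (galaxy_ext_pair hh))).
    by move=> [/eqP]; rewrite subr_eq0 (negPf ne).
  move=> [n1 _ ht _]; case: (boolP (psi (u - h) <= h)) => hle.
    by case: (hno (psi (u' - h'))); rewrite (succ_sub_le HT ph ne hle).
  rewrite -og_ltNge in hle.
  case: (eqVneq (psi (u - h)) (succ h)) => // nsh.
  case: (hno (succ h')); rewrite (@succ_sub_gt _ _ HT u h) //; first exact: psi_pair_succ.
  by move=> _; rewrite lt_neqAle eq_sym nsh succ_le //; have [] := psi_pair_Psi ht.
have badS z z' : S z z' -> Psi z -> u != z /\ psi (u - z) = succ z.
  by move=> hz pz; apply: (bad _ z'); left; split=> //; exact: good_Psi_imp hz pz.
have badG h h' : gal h h' -> u != h /\ psi (u - h) = succ h.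
  by move=> hh; apply: (bad _ h'); right.
case: hu => [N [a [b [R [l [l' [w [w' [[nN ha hl hw] [e e']]]]]]]]]].
have psiN k : psi (u - k) = psi ((u - k) *~ N) by rewrite psi_mulz.
have nzN k : u != k -> (u - k) *~ N != 0.
  by move=> nk; rewrite og_mulz_eq0 // subr_eq0.
have gw := gcomb_gsim hw hl; have [pl pl' _] := hl.
have galS h h' z z' : gal h h' -> S z z' -> Psi z -> z = h -> False.
  by move=> h1 h2 h3 h4; have := gal_neq h1 h2 h3; rewrite h4 eqxx.
(* For [R = 0] take [h = s (a / N)]. The value of [N (u - h)] is [h], or the value of [w], which
   lies in the galaxy whereas [s h] lies in the domain. *)
case: (eqVneq R 0) => [R0|nR].
  have [a2 [b2 [ha2 ea eb]]] := good_divz ha nN.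
  have hz := good_succ gS ha2; have [pz n1 e1] := succP HT a2.
  have [_ ez] := badS _ _ hz pz; move: ez; rewrite psiN.
  have -> : (u - succ a2) *~ N = (a2 - succ a2) *~ N + w.
    have -> : (u - succ a2) *~ N = u *~ N - succ a2 *~ N by zlin.
    by rewrite e R0 -ea; zlin.
  have nd : (a2 - succ a2) *~ N != 0 by apply: og_mulz_eq0.
  have ed : psi ((a2 - succ a2) *~ N) = succ a2 by rewrite psi_mulz.
  have lts := lt_succ HT pz.
  case: (boolP (succ a2 < psi w)) => hlt.
    have [_ -> _] := small_dom HT nd (r := w) (fun _ => etrans (congr1 (fun k => k < psi w) ed) hlt).
    by rewrite ed => ee; rewrite -ee ltxx in lts.
  case: gw => [[w0 _]|[nw _ hg _ _]].
    by rewrite w0 addr0 ed => ee; rewrite -ee ltxx in lts.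
  have s : small psi ((a2 - succ a2) *~ N) (psi w).
    move=> _; rewrite ed lt_neqAle og_leNgt hlt andbT eq_sym.
    exact: (gal_neq hg hz pz).
  rewrite addrC; have [_ -> _] := small_dom HT nw s.
  by move/esym; apply: (galS _ _ _ _ hg (good_succ gS hz)); exact: Psi_succ.
(* For [R = N] the multiples of [l] cancel in [N (u - h)] when [h] is in the galaxy. With [h] from
   [gcomb_top] the value is that of [a], which lies outside the galaxy of [s h], or is at most
   [h]. *)
case: (eqVneq R N) => [RN|nRN].
  have [h [h' [hh hlh hs hp]]] := gcomb_top R hw hl.
  have [nh eh] := badG _ _ hh; move: eh; rewrite psiN.
  have := nzN _ nh.
  have -> : (u - h) *~ N = a + (w - (h - l) *~ R).
    have -> : (u - h) *~ N = u *~ N - h *~ N by zlin.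
    by rewrite e RN; zlin.
  set B := w - (h - l) *~ R in hs hp *; move=> nab eh.
  have hsh := gal_succ hh.
  have [ph _ _] := hh; have lts := lt_succ HT ph.
  case: (eqVneq a 0) => [a0|na].
    rewrite a0 add0r in nab eh; have := hp nab.
    by rewrite eh og_leNgt lts.
  have pa := psi_Psi psi na; have Sa := good_psi gS ha na.
  case: hs => [[B0 _]|[nB _ hB _ _]].
    by rewrite B0 addr0 in eh; exact: galS hsh Sa pa eh.
  case/orP: (og_total (psi a) (psi B)) => hle.
    have s : small psi B (psi a) by move=> _; rewrite lt_neqAle hle (gal_neq hB Sa pa).
    have [_ ee _] := small_dom HT na s.
    by rewrite ee in eh; exact: galS hsh Sa pa eh.
  have s : small psi a (psi B).
    by move=> _; rewrite lt_neqAle hle eq_sym (gal_neq hB Sa pa).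
  have [_ ee _] := small_dom HT nB s.
  by rewrite addrC ee in eh; have := hp nB; rewrite eh og_leNgt lts.
(* Otherwise let [z] be the successor of [a / (N - R)]. If [z < l], take [h = l]: the value is [z],
   which lies in the domain, unlike [s l]. If [l < z], take [h = z]: the value is a member of the
   galaxy below [z]. *)
have nR1 : R - N != 0 by rewrite subr_eq0.
have [a2 [b2 [ha2 ea eb]]] := good_divz (goodN gS ha) nR1.
have hz := good_succ gS ha2; have [pz n1 e1] := succP HT a2.
set z := succ a2 in hz pz n1 e1.
have a_eq : a = - (a2 *~ (R - N)) by rewrite ea opprK.
have nd : (a2 - z) *~ (N - R) != 0.
  by apply: og_mulz_eq0 => //; rewrite -opprB oppr_eq0.
have ed : psi ((a2 - z) *~ (N - R)) = z.
  by rewrite psi_mulz // -opprB oppr_eq0.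
case: (gal_cut hl hz pz) => -[lt1 lt2].
  have [_ el] := badG _ _ hl; move: el; rewrite psiN.
  have -> : (u - l) *~ N = (a2 - z) *~ (N - R) + ((l - z) *~ (R - N) + w).
    have -> : (u - l) *~ N = u *~ N - l *~ N by zlin.
    by rewrite e a_eq; zlin.
  have s : small psi ((l - z) *~ (R - N) + w) (psi ((a2 - z) *~ (N - R))).
    rewrite ed; apply: (smallD HT); last by apply: (small_le _ (gsim_small gw)); exact: ltW.
    by apply: (smallMz HT) => // _; rewrite (psi_PsiB HT) // (lt_succ HT).
  have [_ -> _] := small_dom HT nd s.
  by rewrite ed => /(galS _ _ _ _ (gal_succ hl) hz pz).
have [_ ez] := badS _ _ hz pz; move: ez; rewrite psiN.
have -> : (u - z) *~ N = (a2 - z) *~ (N - R) + (w - (z - l) *~ R).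
  have -> : (u - z) *~ N = u *~ N - z *~ N by zlin.
  by rewrite e a_eq; zlin.
have [gr nr] := gcomb_far hw hl hz pz lt1 nR.
case: gr => [[r0]|[_ _ hg _ _]]; first by rewrite r0 eqxx in nr.
have hlt : psi (w - (z - l) *~ R) < z.
  have [//|h] := orP (og_total z (psi (w - (z - l) *~ R))); last first.
    by rewrite lt_neqAle h eq_sym (gal_neq hg hz pz).
  rewrite le_eqVlt => /orP[/eqP h|h]; first by case: (galS _ _ _ _ hg hz pz h).
  by have := gal_side hg hl hz pz h; rewrite (lt_gtF lt1).
have s : small psi ((a2 - z) *~ (N - R)) (psi (w - (z - l) *~ R)) by rewrite /small ed.
rewrite addrC; have [_ -> _] := small_dom HT nr s.
by move=> ee; rewrite ee in hlt; have := lt_succ HT pz; rewrite (lt_gtF hlt).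
Qed.

Lemma gal_closed (H : set G) g h : closed_sub psi H -> gal g h ->
  (H x -> H g) /\ (H y -> H h).
Proof.
move=> [_ _ _ Hs Hp] [hg hh [i [j [e1 e2]]]].
have up u v : Psi u -> iter i succ u = iter j succ v -> H v -> H u.
  move=> hu e hv; have : H (iter i succ u) by rewrite e; elim: j {e e1 e2} => //= k; exact: Hs.
  by elim: i {e e1 e2} => //= k IH /Hp; rewrite (pred_eq HT (iter_Psi k hu) erefl).
by split; apply: up.
Qed.

Lemma gcomb_closed (H : set G) l l' w w' : closed_sub psi H -> gcomb l l' w w' ->
  (H l -> H w) /\ (H l' -> H w').
Proof.
move=> cH; have [HB _ _ Hs _] := cH; elim=> {l l' w w'} [l l'|c l l' w w' _ [IH1 IH2]].
  by split=> /[dup] /HB h /h; rewrite subrr.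
by split=> hl; apply: (closedD cH);
  [apply: (closedMz cH); apply: HB => //; exact: Hs|apply: IH1; exact: Hs|
   apply: (closedMz cH); apply: HB => //; exact: Hs|apply: IH2; exact: Hs].
Qed.

(** Confines the extension to closed sets containing the old data. This yields its countability, and
    later keeps its domain inside a closed set chosen in advance. *)
Lemma galaxy_ext_closed (H : set G) u u' : closed_sub psi H -> S' u u' ->
  ((forall a b, S a b -> H a) -> H x -> H u) /\
  ((forall a b, S a b -> H b) -> H y -> H u').
Proof.
move=> cH [N [a [b [R [l [l' [w [w' [[nN ha hl hw] [e e']]]]]]]]]].
have [g1 g2] := gal_closed cH hl; have [c1 c2] := gcomb_closed cH hw.
split=> sub hH; apply: (closed_divz cH nN).
  rewrite e; apply: (closedD cH); last by apply/c1/g1.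
  by apply: (closedD cH); [exact: sub ha|apply: (closedMz cH); exact: g1].
rewrite e'; apply: (closedD cH); last by apply/c2/g2.
by apply: (closedD cH); [exact: sub ha|apply: (closedMz cH); exact: g2].
Qed.

Lemma galaxy_extension : exists S',
  [/\ good psi S', forall a b, S a b -> S' a b, S' x y,
      forall g h, S' g h -> Psi g -> S g h \/ gal g h &
      forall (H : set G) u u', closed_sub psi H -> S' u u' ->
        ((forall a b, S a b -> H a) -> H x -> H u) /\
        ((forall a b, S a b -> H b) -> H y -> H u')].
Proof.
have [gS' hT] : good psi S' /\ forall g h, S' g h -> Psi g -> Psi h -> psi_pair g h.
  apply: (good_of_pairs HT); rewrite -/galaxy_ext.
  - by apply: galaxy_ext_sub; exact: (good0 gS).
  - by move=> *; exact: galaxy_extB.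
  - by move=> *; exact: galaxy_ext_div.
  - by move=> a b /galaxy_ext_sim [[-> ->]|[_ _ _]].
  - by move=> g h hg; have [] := psi_pair_Psi hg; split=> //; exact: galaxy_ext_pair.
  - by move=> g h; exact: psi_pair_pred.
  - by move=> a b /galaxy_ext_sim [[-> _]|[]]; rewrite ?eqxx.
  - by move=> a b; exact: galaxy_ext_succ.
exists S'; split=> //; last by move=> H u u'; exact: galaxy_ext_closed.
- exact: galaxy_ext_sub.
- exact/galaxy_ext_gal/gal_refl.
- move=> g h hgh pg; have ph := good_Psi_imp HT gS' hgh pg.
  by case: (hT _ _ hgh pg ph) => [[]|]; [left|right].
Qed.

End GalaxyExtension.

(** * Adjoining an arbitrary element in a saturated couple *)

Lemma countable_enum (T : Type) (A : set T) : countable A -> A !=set0 ->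
  exists f : nat -> T, (forall i, A (f i)) /\ forall a, A a -> exists i, f i = a.
Proof.
move=> /countable_injP [f finj] [a0 ha0].
have hP (P : set T) : exists g : T, (P !=set0 -> P g) /\ (~ (P !=set0) -> g = a0).
  case: (pselect (P !=set0)) => [[p hp]|h]; first by exists p; split=> // h; case: h; exists p.
  by exists a0.
have [g hg] := choice (fun i => hP [set a | A a /\ f a = i]).
exists g; split=> [i|a ha].
  case: (pselect ([set a | A a /\ f a = i] !=set0)) => h; first by have [/(_ h)[]] := hg i.
  by have [_ /(_ h) ->] := hg i.
exists (f a); have [h _] := hg (f a).
have [|h1 h2] := h; first by exists a.
by apply: finj; rewrite ?inE.
Qed.

Lemma countable_setU (T : Type) (A B : set T) :
  countable A -> countable B -> countable (A `|` B).
Proof.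
move=> cA cB; have -> : A `|` B = \bigcup_(b in [set: bool]) (if b then A else B).
  apply/seteqP; split=> [a [h|h]|a [[] _ h]];
    by [exists true|exists false|left|right].
by apply: bigcup_countable => // -[].
Qed.

(** * Countable closed sets *)

Section CountableClosure.
Variables (G : orderedZmodType) (psi : G -> G).

Definition closure_op (k : nat) (a b : G) : G :=
  match k with
  | 0 => a - b
  | 1 => psi a
  | 2 => succ psi a
  | 3 => pred_Psi psi a
  | n.+4 => div_by n.+1 a
  end.

Lemma countable_closure (A : set G) : countable A ->
  exists H, [/\ countable H, closed_sub psi H & A `<=` H].
Proof.
move=> cA.
pose step (B : set G) : set G :=
  B `|` [set closure_op p.1 p.2.1 p.2.2 | p in setT `*` (B `*` B)].
pose B i := iter i step A.
have cB i : countable (B i).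
  elim: i => //= i IH; rewrite /step /= -/(B i).
  apply: countable_setU => //.
  apply: (sub_countable (card_image_le _ _)).
  by apply: countableX => //; exact: countableX.
have Bmono i j : (i <= j)%N -> B i `<=` B j.
  move/subnK <-; elim: (j - i)%N => // k IH a /IH h; by left.
have opB k a b i j : B i a -> B j b -> (\bigcup_i B i) (closure_op k a b).
  move=> ha hb; exists (maxn i j).+1 => //; right; exists (k, (a, b)) => //.
  split=> //; split=> /=; [apply: Bmono ha|apply: Bmono hb];
    by rewrite ?leq_maxl ?leq_maxr.
exists (\bigcup_i B i); split.
- exact: bigcup_countable.
- split.
  + by move=> a b [i _ hi] [j _ hj]; exact: (opB 0%N a b i j).
  + by move=> n a [i _ hi]; exact: (opB n.+4 a a i i).
  + by move=> a [i _ hi]; exact: (opB 1%N a a i i).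
  + by move=> a [i _ hi]; exact: (opB 2%N a a i i).
  + by move=> a [i _ hi]; exact: (opB 3%N a a i i).
- by move=> a ha; exists 0%N.
Qed.

End CountableClosure.

(* Saturation, for the two kinds of conditions that are needed; the sets in
   [I] are to be thought of as the internal ones. *)
Record saturated (G : orderedZmodType) (psi : G -> G) (I : set (set G)) : Prop :=
  Saturated {
  sat_setT : I setT;
  sat_gt : forall a, I [set y | Psi psi y /\ a < y];
  sat_lt : forall a, I [set y | Psi psi y /\ y < a];
  sat_val : forall (a y : G) (e : bool),
    I [set g | [/\ g != a, (a < g) = e & psi (g - a) = y]];
  sat_cap : forall D : nat -> set G, (forall i, I (D i)) ->
    (forall n, exists g, forall i, (i < n)%N -> D i g) ->
    exists g, forall i, D i g }.

Section Extensions.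
Variables (G : orderedZmodType) (psi : G -> G).
Hypothesis HT : model_T0 psi.
Variable I : set (set G).
Hypothesis sI : saturated psi I.
Implicit Types (a b c d g h u x y z : G) (S T : G -> G -> Prop).

Local Notation Psi := (Psi psi).
Local Notation succ := (succ psi).
Local Notation pred_Psi := (pred_Psi psi).

Definition cgood S := good psi S /\ countable [set p : G * G | S p.1 p.2].

Lemma cgood_enum S : cgood S -> exists f : nat -> G * G,
  (forall i, S (f i).1 (f i).2) /\ forall a b, S a b -> exists i, f i = (a, b).
Proof.
move=> [gS cS]; have [|f [h1 h2]] := countable_enum cS.
  by exists (0, 0); exact: good0 gS.
by exists f; split=> // a b hab; apply: (h2 (a, b)).
Qed.

Lemma countable_proj S : countable [set p : G * G | S p.1 p.2] ->
  countable [set a | exists b, S a b] /\ countable [set b | exists a, S a b].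
Proof.
move=> cS; split.
  have -> : [set a | exists b, S a b] = [set p.1 | p in [set p : G * G | S p.1 p.2]].
    by apply/seteqP; split=> [a [b h]|a [[c d] h /= <-]]; [exists (a, b)|exists d].
  exact: (sub_countable (card_image_le _ _)).
have -> : [set b | exists a, S a b] = [set p.2 | p in [set p : G * G | S p.1 p.2]].
  by apply/seteqP; split=> [b [a h]|b [[c d] h /= <-]]; [exists (a, b)|exists c].
exact: (sub_countable (card_image_le _ _)).
Qed.

Lemma countableU1 (A : set G) x : countable A -> countable (x |` A).
Proof. by move=> cA; apply: countable_setU => //; exact: countable1. Qed.

Lemma cgood_ext S S' x y : cgood S -> good psi S' ->
  (forall (H : set G) u u', closed_sub psi H -> S' u u' ->
        ((forall a b, S a b -> H a) -> H x -> H u) /\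
        ((forall a b, S a b -> H b) -> H y -> H u')) -> cgood S'.
Proof.
move=> [gS /countable_proj[c1 c2]] gS' h; split=> //.
have [H1 [cH1 clH1 s1]] := countable_closure psi (countableU1 x c1).
have [H2 [cH2 clH2 s2]] := countable_closure psi (countableU1 y c2).
apply: (@sub_countable _ _ _ (H1 `*` H2)); last exact: countableX.
apply: subset_card_le => -[u u'] /= hu; split=> /=.
  have [+ _] := h _ _ _ clH1 hu; apply; last by apply: s1; left.
  by move=> a b hab; apply: s1; right; exists b.
have [_ +] := h _ _ _ clH2 hu; apply; last by apply: s2; left.
by move=> a b hab; apply: s2; right; exists a.
Qed.

Lemma realize_cut S x : cgood S -> Psi x -> (forall b, ~ S x b) ->
  exists y, Psi y /\ same_cut psi S x y.
Proof.
move=> cS hx nx; have [gS _] := cS; have [f [f1 f2]] := cgood_enum cS.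
have ne a b : S a b -> a != x.
  by move=> hab; apply/eqP => e; apply: (nx b); rewrite -e.
pose D i := if `[< Psi (f i).1 >] then
    if (f i).1 < x then [set y | Psi y /\ (f i).2 < y] else [set y | Psi y /\ y < (f i).2]
  else setT.
have [||y hy] := sat_cap sI (D := D).
- move=> i; rewrite /D; case: asboolP => _; last exact: sat_setT sI.
  by case: ifP => _; [exact: sat_gt sI _|exact: sat_lt sI _].
- move=> n.
  (* The greatest of the finitely many listed elements below [x]; the search starts at [s 0], which
     is below [x]. *)
  have [a [b [hab pa lax hmax]]] : exists a b, [/\ S a b, Psi a, a < x &
      forall i, (i < n)%N -> Psi (f i).1 -> (f i).1 < x -> (f i).1 <= a].
    elim: n => [|n [a [b [hab pa lax hmax]]]].
      exists (succ 0), (succ 0); split=> //; [exact: good_s0|exact: T0_s0_Psi|].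
      rewrite lt_neqAle (T0_s0_least HT hx) andbT; apply: (ne _ (succ 0)).
      exact: good_s0.
    case: (pselect (Psi (f n).1 /\ (f n).1 < x /\ a < (f n).1)) => [[p1 [p2 p3]]|h].
      exists (f n).1, (f n).2; split=> // i; rewrite ltnS leq_eqVlt => /predU1P[->//|lin] q1 q2.
      by apply: le_trans (hmax _ lin q1 q2) _; exact: ltW.
    exists a, b; split=> // i; rewrite ltnS leq_eqVlt => /predU1P[->|lin] q1 q2.
      by rewrite og_leNgt; apply/negP => l; apply: h.
    exact: hmax.
  have pb := good_Psi_imp HT gS hab pa; have hs := good_succ gS hab.
  have sa := Psi_succ HT pa; have sb := Psi_succ HT pb.
  (* The inequalities are strict, so [b] itself does not qualify when [a] is listed. [s b] does:
     [s a] is in the domain and [x] is not, hence [s a < x]. *)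
  exists (succ b) => i lin; rewrite /D; case: asboolP => // pi.
  case: ifPn => li; split=> //.
    apply: le_lt_trans (lt_succ HT pb).
    by rewrite -(good_le gS (f1 i) hab); apply: hmax.
  rewrite -(good_lt gS hs (f1 i)).
  have : succ a < x by rewrite lt_neqAle succ_le // lax (ne _ _ hs).
  by move=> l; apply: lt_le_trans l _; rewrite og_leNgt.
(* Only the conditions coming from [Psi] put [y] into [Psi]; the pair of [s 0] is one of them. *)
have py : Psi y.
  have [i ei] := f2 _ _ (good_s0 gS); have := hy i; rewrite /D ei /=.
  rewrite asboolT; last exact: T0_s0_Psi.
  by case: ifP => _ [].
exists y; split=> // a b hab pa; have [i ei] := f2 _ _ hab.
have := hy i; rewrite /D ei /= asboolT //.
case: ifPn => l [_ h]; [by left|right; split=> //].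
by rewrite lt_neqAle eq_sym (ne _ _ hab) og_leNgt.
Qed.

Lemma add_Psi S x : cgood S -> Psi x -> exists S',
  [/\ cgood S', forall a b, S a b -> S' a b, exists y, S' x y &
    forall H : set G, closed_sub psi H -> (forall a b, S a b -> H a) -> H x ->
      forall a b, S' a b -> H a].
Proof.
move=> cS hx; have [gS _] := cS.
case: (pselect (exists b, S x b)) => [[b hb]|/forallNP nx].
  by exists S; split=> [||| H _ h _] //; exists b.
have [y [hy hc]] := realize_cut cS hx nx.
have [S' [gS' sub hxy _ hH]] := galaxy_extension HT gS hx hy hc.
exists S'; split=> //; [exact: cgood_ext cS gS' hH|by exists y|].
by move=> H cH h1 h2 a b hab; have [+ _] := hH H a b cH hab; apply.
Qed.

Lemma add_Psi_seq S (xs : nat -> G) : cgood S -> (forall i, Psi (xs i)) ->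
  exists S', [/\ cgood S', forall a b, S a b -> S' a b,
    forall i, exists y, S' (xs i) y &
    forall H : set G, closed_sub psi H -> (forall a b, S a b -> H a) ->
      (forall i, H (xs i)) -> forall a b, S' a b -> H a].
Proof.
move=> cS hxs.
have hF (p : (G -> G -> Prop) * G) : exists S', cgood p.1 -> Psi p.2 ->
  [/\ cgood S', forall a b, p.1 a b -> S' a b, exists y, S' p.2 y &
    forall H : set G, closed_sub psi H -> (forall a b, p.1 a b -> H a) -> H p.2 ->
      forall a b, S' a b -> H a].
  case: (pselect (cgood p.1 /\ Psi p.2)) => [[h1 h2]|h]; last by exists p.1 => h1 h2; case: h.
  by have [S' hS'] := add_Psi h1 h2; exists S'.
have [F {}hF] := choice hF.
pose fix Sn i := if i is j.+1 then F (Sn j, xs j) else S.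
have cSn i : cgood (Sn i).
  by elim: i => //= i IH; have [] := hF (Sn i, xs i) IH (hxs i).
have subS i a b : Sn i a b -> Sn i.+1 a b.
  by have [_ h _ _] := hF (Sn i, xs i) (cSn i) (hxs i); exact: h.
have mono i j a b : (i <= j)%N -> Sn i a b -> Sn j a b.
  by move/subnK <-; elim: (j - i)%N => // k IH h; rewrite addSn; apply/subS/IH.
exists (fun a b => exists i, Sn i a b); split.
- have two a b c d : (exists i, Sn i a b) -> (exists i, Sn i c d) ->
      exists i, Sn i a b /\ Sn i c d.
    move=> [i hi] [j hj]; exists (maxn i j).
    by split; [apply: mono hi|apply: mono hj]; rewrite ?leq_maxl ?leq_maxr.
  split.
    split.
    + by exists 0%N; exact: good0 cS.1.
    + move=> a b c d h1 h2; have [i [k1 k2]] := two _ _ _ _ h1 h2.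
      by exists i; exact: goodB (cSn i).1 _ _ _ _ k1 k2.
    + by move=> n a b [i hi]; exists i; exact: good_div (cSn i).1 n _ _ hi.
    + by move=> a b [i hi]; exact: good_pos (cSn i).1 _ _ hi.
    + by move=> a b [i hi] na; exists i; exact: good_psi (cSn i).1 _ _ hi na.
    + by move=> a b [i hi]; exists i; exact: good_succ (cSn i).1 _ _ hi.
    + move=> a b [i hi] p1 p2 l; exists i.
      exact: good_pred (cSn i).1 _ _ hi p1 p2 l.
  have -> : [set p : G * G | exists i, Sn i p.1 p.2] =
      \bigcup_i [set p : G * G | Sn i p.1 p.2].
    by apply/seteqP; split=> p [i]; exists i.
  by apply: bigcup_countable => // i _; have [] := cSn i.
- by move=> a b h; exists 0%N.
- move=> i; have [_ _ [y hy] _] := hF (Sn i, xs i) (cSn i) (hxs i).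
  by exists y, i.+1.
- move=> H cH h1 h2 a b [i]; elim: i a b => [|i IH] a b; first exact: h1.
  have [_ _ _ h] := hF (Sn i, xs i) (cSn i) (hxs i).
  by move=> hab; apply: (h H cH IH (h2 i) a b hab).
Qed.

End Extensions.

(** * Realizing a cut together with its values *)

Section CutExtension.
Variables (G : orderedZmodType) (psi : G -> G).
Hypothesis HT : model_T0 psi.
Variable I : set (set G).
Hypothesis sI : saturated psi I.
Implicit Types (a b c d g h u x y z : G) (S T : G -> G -> Prop).

Local Notation Psi := (Psi psi).
Local Notation succ := (succ psi).

(** Positive elements do not cancel: convexity bounds the value above by both values, AC1 bounds it
    below by their minimum. *)
Lemma psiD_pos p q : 0 < p -> 0 < q ->
  psi (p + q) = if psi p <= psi q then psi p else psi q.
Proof.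
move=> hp hq; have hpq : 0 < p + q by apply: og_addr_gt0 => //; exact: ltW.
have l1 : psi (p + q) <= psi p.
  by apply: (T0_H_type HT) => //; rewrite -{1}[p]addr0 og_leD2l ltW.
have l2 : psi (p + q) <= psi q.
  by apply: (T0_H_type HT) => //; rewrite -{1}[q]add0r addrC [leRHS]addrC og_leD2l ltW.
have := ac1 (T0_couple HT) (og_gt0_neq0 hp) (og_gt0_neq0 hq) (og_gt0_neq0 hpq).
rewrite minEle; case: ifP => _ l3; apply/le_anti; by rewrite l3 ?l1 ?l2.
Qed.

Lemma ex_pos_psi y : Psi y -> exists2 e, 0 < e & psi e = y.
Proof.
move=> [a /= na <-]; case: (og_cases a) => h.
- by exists (- a); [rewrite og_oppr_gt0|rewrite psiN].
- by rewrite h eqxx in na.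
- by exists a.
Qed.

(* [g] lies over [b] as [c] lies over [a]. *)
Definition matches S (c g a b : G) :=
  [/\ c != a, g != b, (a < c) = (b < g) & S (psi (c - a)) (psi (g - b))].

Lemma matchesN S c g a b : matches S c g a b -> matches S (- c) (- g) (- a) (- b).
Proof.
have lN (k m : G) : k != m -> (- k < - m) = ~~ (k < m).
  by move=> ne; rewrite -(og_subr_gt0 (- k)) opprK addrC og_subr_gt0 og_ltNge le_eqVlt (negPf ne).
move=> [h1 h2 h3 h4]; split; rewrite ?(inj_eq oppr_inj) //.
  by rewrite (lN a c) 1?eq_sym // (lN b g) 1?eq_sym // h3.
by rewrite -!opprD !(psiN HT).
Qed.

(** [c - a1 = (c - a) + (a - a1)] is a sum of nonnegative terms, so its value is computed from the
    one at [a] and from data in [S]. Hence among finitely many elements below [c] only the nearest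
    one matters. *)
Lemma matches_lower S c g a b a1 b1 : good psi S -> S a b -> S a1 b1 ->
  a1 <= a -> a < c -> matches S c g a b -> matches S c g a1 b1.
Proof.
move=> gS h h1 hle hlt [n1 n2 e hS].
have hlt' : b < g by rewrite -e.
have hle' : b1 <= b by rewrite -(good_le gS h1 h).
have l1 := le_lt_trans hle hlt; have l1' := le_lt_trans hle' hlt'.
split; rewrite ?(gt_eqF l1) ?(gt_eqF l1') ?l1 ?l1' //.
case: (eqVneq a1 a) => [ea|na].
  by move: h1; rewrite ea => /(good_fun gS h) <-.
have p1 : 0 < a - a1 by rewrite og_subr_gt0 lt_neqAle na.
have p1' : 0 < b - b1 by rewrite -(good_pos gS (goodB gS h h1)).
have p2 : 0 < c - a by rewrite og_subr_gt0.
have p2' : 0 < g - b by rewrite og_subr_gt0.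
have -> : c - a1 = (c - a) + (a - a1) by zlin.
have -> : g - b1 = (g - b) + (b - b1) by zlin.
have hS' := good_psi gS (goodB gS h h1) (og_gt0_neq0 p1).
by rewrite (psiD_pos p2 p1) (psiD_pos p2' p1') -(good_le gS hS hS'); case: ifP.
Qed.

Lemma matches_above S c a b y : good psi S -> S a b -> a < c ->
  S (psi (c - a)) y -> exists2 e, 0 < e & psi e = y /\ matches S c (b + e) a b.
Proof.
move=> gS h hlt hS.
have pc : Psi (psi (c - a)) by apply: psi_Psi; rewrite subr_eq0 gt_eqF.
have [e he ee] := ex_pos_psi (good_Psi_imp HT gS hS pc); exists e => //; split=> //.
have l : b < b + e by rewrite -(og_subr_gt0 b) addrC addKr.
have eb : b + e - b = e by zlin.
by split; rewrite ?(gt_eqF hlt) ?(gt_eqF l) ?hlt ?l // eb ee.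
Qed.

(* Between two neighbours of [c], the closer of which is the lower one. *)
Lemma matches_between S c a b a' b' y y' : good psi S -> S a b -> S a' b' ->
  a < c -> c < a' -> S (psi (c - a)) y -> S (psi (a' - c)) y' ->
  psi (a' - c) <= psi (c - a) ->
  exists g, matches S c g a b /\ matches S c g a' b'.
Proof.
move=> gS h h' l l' hy hy' hle.
have p1 : 0 < c - a by rewrite og_subr_gt0.
have p2 : 0 < a' - c by rewrite og_subr_gt0.
have eD : psi (a' - a) = psi (a' - c).
  have -> : a' - a = (a' - c) + (c - a) by zlin.
  by rewrite (psiD_pos p2 p1) hle.
have hD := goodB gS h' h.
have p3 : 0 < a' - a by rewrite og_subr_gt0 (lt_trans l).
have p3' : 0 < b' - b by rewrite -(good_pos gS hD).
have eD' : psi (b' - b) = y'.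
  by have := good_psi gS hD (og_gt0_neq0 p3); rewrite eD => /(good_fun gS hy').
have up g : 0 < b' - g -> psi (b' - g) = y' -> matches S c g a' b'.
  rewrite og_subr_gt0 => lg eg.
  by split; rewrite ?(lt_eqF l') ?(lt_eqF lg) ?(lt_gtF l') ?(lt_gtF lg) // psiBC // [psi (g - _)]psiBC // eg.
(* Equal distances: the midpoint, since half of [b' - b] has the same value as [b' - b]. *)
case: (eqVneq (psi (a' - c)) (psi (c - a))) => e.
  pose e2 := div_by 2 (b' - b).
  have he2 : e2 *+ 2 = b' - b := div_byK HT 1 _.
  have pe2 : 0 < e2 by rewrite -(og_muln_pos _ 1) he2.
  have pse : psi e2 = y' by rewrite -eD' -he2 (psi_muln HT).
  have lb : b < b + e2 by rewrite -(og_subr_gt0 b) addrC addKr.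
  exists (b + e2); split.
    have eb : b + e2 - b = e2 by zlin.
    by split; rewrite ?(gt_eqF l) ?(gt_eqF lb) ?l ?lb // eb pse -e.
  have eb : b' - (b + e2) = e2.
    have -> : b' = b + e2 *+ 2 by rewrite he2 addrC subrK.
    by zlin.
  by apply: up; rewrite eb.
(* Unequal distances: any [e2] of the value required near [b] is negligible against [b' - b], so the
   value near [b'] is automatic. *)
have lts : psi (a' - c) < psi (c - a) by rewrite lt_neqAle e.
have [e2 pe2 [pse hm]] := matches_above gS h l hy.
exists (b + e2); split=> //.
have s : small psi (- e2) (psi (b' - b)).
  by move=> _; rewrite (psiN HT) pse eD' -(good_lt gS hy' hy).
have [_ h1 h2] := small_dom HT (og_gt0_neq0 p3') s.
have eb : b' - (b + e2) = (b' - b) + - e2 by zlin.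
by apply: up; rewrite eb ?h2 // h1.
Qed.

Lemma nearest_lower S c (f : nat -> G * G) n : (forall i, S (f i).1 (f i).2) ->
  (forall i, (i < n)%N -> ~ (f i).1 < c) \/
  exists a b, [/\ S a b, a < c & forall i, (i < n)%N -> (f i).1 < c -> (f i).1 <= a].
Proof.
move=> hf; elim: n => [|n [IH|[a [b [h l hm]]]]]; first by left.
  case: (pselect ((f n).1 < c)) => hn.
    right; exists (f n).1, (f n).2; split=> // i; rewrite ltnS leq_eqVlt.
    by move=> /predU1P[->//|/IH].
  by left=> i; rewrite ltnS leq_eqVlt => /predU1P[->|/IH].
right; case: (pselect ((f n).1 < c /\ a < (f n).1)) => [[h1 h2]|hn].
  exists (f n).1, (f n).2; split=> // i; rewrite ltnS leq_eqVlt => /predU1P[->//|hi hc].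
  by apply: le_trans (hm _ hi hc) _; exact: ltW.
exists a, b; split=> // i; rewrite ltnS leq_eqVlt => /predU1P[->|hi] hc; last exact: hm.
by rewrite og_leNgt; apply/negP => hl; apply: hn.
Qed.

Lemma realize_matches S c : cgood psi S -> (forall b, ~ S c b) ->
  (forall a b, S a b -> exists y, S (psi (c - a)) y) ->
  exists g, forall a b, S a b -> matches S c g a b.
Proof.
move=> cS nc hpsi; have [gS _] := cS; have [f [f1 f2]] := cgood_enum cS.
have ne a b : S a b -> c != a.
  by move=> hab; apply/eqP => e; apply: (nc b); rewrite e.
have [Y hY] := choice (fun i => hpsi _ _ (f1 i)).
pose D i := [set g | [/\ g != (f i).2, ((f i).2 < g) = ((f i).1 < c) &
  psi (g - (f i).2) = Y i]].
have DP i g : D i g <-> matches S c g (f i).1 (f i).2.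
  split=> [[h1 h2 h3]|[h1 h2 h3 h4]]; first by split; rewrite ?h3 // (ne _ _ (f1 i)).
  by split=> //; apply: (good_fun gS h4 (hY i)).
have [||g hg] := sat_cap sI (D := D).
- by move=> i; exact: sat_val sI _ _ _.
- move=> n.
  (* Negation reverses the order, so [nearest_lower] for [fN] and [- c] provides the nearest upper
     neighbour. *)
  pose fN i := (- (f i).1, - (f i).2).
  have fN1 i : S (fN i).1 (fN i).2 by exact: goodN gS _ _ (f1 i).
  have lN (k m : G) : (- k < m) = (- m < k).
    by rewrite -(og_subr_gt0 (- k)) opprK addrC -(og_subr_gt0 (- m)) opprK.
  have dist a b : S a b -> exists y, S (psi (c - a)) y by exact: hpsi.
  (* a candidate which is right for the neighbours is right for everything *)
  suff [g [g1 g2]] : exists g,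
      (forall i, (i < n)%N -> (f i).1 < c -> D i g) /\
      (forall i, (i < n)%N -> c < (f i).1 -> D i g).
    exists g => i hi; case: (og_cases ((f i).1 - c)) => h.
    + by apply: g1 => //; rewrite -(og_subr_gt0 (f i).1) -opprB og_oppr_gt0.
    + by move: (ne _ _ (f1 i)); rewrite eq_sym -subr_eq0 h eqxx.
    + by apply: g2 => //; rewrite -(og_subr_gt0 c).
  have low a b g : S a b -> a < c ->
      (forall i, (i < n)%N -> (f i).1 < c -> (f i).1 <= a) ->
      matches S c g a b -> forall i, (i < n)%N -> (f i).1 < c -> D i g.
    by move=> h l hm hg i hi hc; apply/DP; apply: (matches_lower gS h (f1 i) _ l hg); apply: hm.
  have upp a b g : S (- a) (- b) -> - a < - c ->
      (forall i, (i < n)%N -> (fN i).1 < - c -> (fN i).1 <= - a) ->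
      matches S c g a b -> forall i, (i < n)%N -> c < (f i).1 -> D i g.
    move=> h l hm hg i hi hc; apply/DP.
    rewrite -[c]opprK -[g]opprK -[(f i).1]opprK -[(f i).2]opprK; apply: matchesN.
    apply: (matches_lower gS h (fN1 i) _ l (matchesN hg)); apply: hm => //.
    by rewrite lN opprK.
  have upE i : ((fN i).1 < - c) = (c < (f i).1) by rewrite lN opprK.
  case: (nearest_lower c n f1) => [nl|[a [b [h l hm]]]];
    case: (nearest_lower (- c) n fN1) => [nu|[a' [b' [h' l' hm']]]].
  + by exists 0; split=> i hi hc; [case: (nl i hi hc)|case: (nu i hi); rewrite upE].
  + have [y hy] := dist _ _ (goodN gS h').
    have hy' : S (psi (- c - a')) y.
      have -> : - c - a' = - (c - - a') by zlin.
      by rewrite (psiN HT).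
    have [e he [_ hg]] := matches_above gS h' l' hy'.
    exists (- (b' + e)); split=> i hi hc; first by case: (nl i hi hc).
    apply: (upp (- a') (- b') _ _ _ _ _ i hi hc); rewrite ?opprK //.
    by rewrite -[c]opprK; exact: matchesN.
  + have [y hy] := dist _ _ h; have [e he [_ hg]] := matches_above gS h l hy.
    exists (b + e); split=> i hi hc; first exact: low hm hg i hi hc.
    by case: (nu i hi); rewrite upE.
  + have [y hy] := dist _ _ h; have [y' hy'] := dist _ _ (goodN gS h').
    have hN := goodN gS h'; have lc : c < - a' by rewrite -[c]opprK lN opprK.
    have [g [g1 g2]] : exists g, matches S c g a b /\ matches S c g (- a') (- b').
      rewrite psiBC // in hy'.
      case/orP: (og_total (psi (- a' - c)) (psi (c - a))) => hle.
        exact: matches_between gS h hN l lc hy hy' hle.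
      (* The upper neighbour is the closer one: reflect everything to reach the case treated in
         [matches_between]. *)
      have e1 : - c - a' = - a' - c by zlin.
      have e2 : - a - - c = c - a by zlin.
      have q : - c < - a by rewrite lN opprK.
      have [|||g [g1 g2]] := matches_between gS h' (goodN gS h) l' q (y := y') (y' := y).
      * by rewrite e1.
      * by rewrite e2.
      * by rewrite e1 e2.
      exists (- g); rewrite -[c]opprK -[a]opprK -[b]opprK; split; exact: matchesN.
    exists g; split; first exact: low hm g1.
    by apply: upp g2; rewrite ?opprK.
exists g => a b hab; have [i ei] := f2 _ _ hab.
by have /DP := hg i; rewrite ei.
Qed.

End CutExtension.

(** * Adjoining one element without enlarging Psi *)

Section RankOneExtension.
Variables (G : orderedZmodType) (psi : G -> G).
Hypothesis HT : model_T0 psi.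
Implicit Types (a b u x y z : G).

Local Notation Psi := (Psi psi).
Local Notation succ := (succ psi).

Variables (S : G -> G -> Prop) (c g : G) (H : set G).
Hypotheses (gS : good psi S) (cH : closed_sub psi H) (SH : forall a b, S a b -> H a)
  (cHc : H c) (HS : forall x, H x -> Psi x -> exists y, S x y)
  (hm : forall a b, S a b -> matches psi S c g a b).

Definition rank_one_ext u u' := exists (N : int) a b (m : int),
  [/\ N != 0, S a b, u *~ N = a + c *~ m & u' *~ N = b + g *~ m].

Local Notation S' := rank_one_ext.

Lemma rank_one_sub a b : S a b -> S' a b.
Proof. by move=> h; exists 1, a, b, 0; rewrite !mulr0z !addr0 !mulr1z. Qed.

Lemma rank_one_new : S' c g.
Proof. by exists 1, 0, 0, 1; rewrite !mulr1z !add0r; split=> //; exact: (good0 gS). Qed.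

(** For [m != 0], [N u = m (c - a2)] with [a2 = - a / m] in the domain, so sign and value are read
    off from [matches]. *)
Lemma rank_one_sim u u' : S' u u' ->
  (0 < u) = (0 < u') /\ (u != 0 -> S (psi u) (psi u')).
Proof.
move=> [N [a [b [m [nN hab e e']]]]].
case: (eqVneq m 0) => [m0|nm].
  rewrite m0 !mulr0z !addr0 in e e'.
  have [a2 [b2 [hS ea eb]]] := good_divz HT gS hab nN.
  have inj (k l : G) : k *~ N = l *~ N -> k = l.
    move=> ekl; apply/eqP; rewrite -subr_eq0; apply: contraTT isT => ne.
    have : (k - l) *~ N != 0 by exact: og_mulz_eq0.
    by rewrite mulrzBl ekl subrr eqxx.
  have -> : u = a2 by apply: inj; rewrite e.
  have -> : u' = b2 by apply: inj; rewrite e'.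
  by split; [exact: (good_pos gS hS)|exact: (good_psi gS hS)].
have [a2 [b2 [hS ea eb]]] := good_divz HT gS (goodN gS hab) nm.
have [n1 n2 e1 e2] := hm hS.
have nd : c - a2 != 0 by rewrite subr_eq0.
have nd' : g - b2 != 0 by rewrite subr_eq0.
have eu : u *~ N = (c - a2) *~ m.
  by rewrite e mulrzBl ea opprK addrC.
have eu' : u' *~ N = (g - b2) *~ m.
  by rewrite e' mulrzBl eb opprK addrC.
have nu : u != 0.
  by apply: contraNneq (og_mulz_eq0 nd nm) => u0; rewrite -eu u0 mul0rz.
have nu' : u' != 0.
  by apply: contraNneq (og_mulz_eq0 nd' nm) => u0; rewrite -eu' u0 mul0rz.
have ps : psi u = psi (c - a2) by rewrite -(psi_mulz HT u nN) eu psi_mulz.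
have ps' : psi u' = psi (g - b2) by rewrite -(psi_mulz HT u' nN) eu' psi_mulz.
split; last by rewrite ps ps'.
have : (0 < u *~ N) = (0 < u' *~ N).
  by rewrite eu eu' !pos_mulz // !og_subr_gt0 e1.
by rewrite !pos_mulz //; case: (0 < u); case: (0 < u'); case: (0 < N).
Qed.

Lemma rank_one_dom u u' : S' u u' -> H u.
Proof.
move=> [N [a [b [m [nN hab e e']]]]]; apply: (closed_divz cH nN); rewrite e.
by apply: (closedD cH); [exact: (SH hab)|exact: (closedMz cH)].
Qed.

Lemma rank_one_good : good psi S'.
Proof.
have [_ _ _ Hs _] := cH.
suff [] : good psi S' /\ forall x y, S' x y -> Psi x -> Psi y ->
  [/\ S x y, Psi x & Psi y] by [].
apply: (good_of_pairs HT).
- by apply: rank_one_sub; exact: (good0 gS).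
- move=> u1 u1' u2 u2' [N1 [a1 [b1 [m1 [n1 h1 e1 e1']]]]] [N2 [a2 [b2 [m2 [n2 h2 e2 e2']]]]].
  exists (N1 * N2), (a1 *~ N2 - a2 *~ N1), (b1 *~ N2 - b2 *~ N1), (m1 * N2 - m2 * N1).
  have e k l : (k - l) *~ (N1 * N2) = (k *~ N1) *~ N2 - (l *~ N2) *~ N1 by zlin.
  split; rewrite ?mulf_neq0 //.
  + by apply: (goodB gS); apply: (goodMz gS).
  + by rewrite e e1 e2; zlin.
  + by rewrite e e1' e2'; zlin.
- move=> n u u' [N [a [b [m [nN h e e']]]]].
  exists (n.+1%:Z * N), a, b, m; split; rewrite ?mulf_neq0 //;
  by rewrite mulrzA -pmulrn (div_byK HT).
- by move=> u u' /rank_one_sim[].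
- by move=> x y [h1 h2 h3]; split=> //; exact: rank_one_sub.
- move=> x y [h1 h2 h3] l; have l' : succ 0 < y by rewrite -(good_lt gS (good_s0 gS) h1).
  by split; [exact: (good_pred gS)|have [] := predP HT h2 l|have [] := predP HT h3 l'].
- move=> u u' hu nu; have [hpos hS] := rank_one_sim hu; have hp := hS nu.
  split=> //; first exact: psi_Psi.
  exact: (good_Psi_imp HT gS hp (psi_Psi _ nu)).
(* [s u] lies in the closed set [H], whose elements of [Psi] are already in the domain of [S]. *)
- move=> u u' hu; have [ps _ _] := succP HT u.
  have [y hy] := HS (Hs _ (rank_one_dom hu)) ps.
  by exists y; split=> //; exact: (good_Psi_imp HT gS hy ps).
Qed.

Lemma rank_one_closed (K : set G) u u' : closed_sub psi K -> S' u u' ->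
  ((forall a b, S a b -> K a) -> K c -> K u) /\
  ((forall a b, S a b -> K b) -> K g -> K u').
Proof.
move=> cK [N [a [b [m [nN hab e e']]]]].
split=> sub hK; apply: (closed_divz cK nN); rewrite ?e ?e'; apply: (closedD cK);
  by [exact: (sub _ _ hab)|exact: (closedMz cK)].
Qed.

End RankOneExtension.

(** * The back-and-forth system *)

Section SaturatedElementarity.
Variables (G : orderedZmodType) (psi : G -> G).
Hypothesis HT : model_T0 psi.
Variable I : set (set G).
Hypothesis sI : saturated psi I.
Implicit Types (a b c : G) (S : G -> G -> Prop).

(** The countable closed set [H] is fixed before anything is adjoined. Adding all of its elements of
    [Psi] keeps the domain inside [H], so for every [a] of the enlarged domain [psi (c - a)] lies in
    [H] and has been added; a single pass suffices. *)
Lemma cgood_forth S c : cgood psi S -> exists S' g,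
  [/\ cgood psi S', forall a b, S a b -> S' a b & S' c g].
Proof.
move=> cS; have [c1 _] := countable_proj cS.2.
have [H [cntH cH sH]] := countable_closure psi (countableU1 c c1).
have Hc : H c by apply: sH; left.
have SH a b : S a b -> H a by move=> h; apply: sH; right; exists b.
have [HB _ Hp Hs _] := cH.
have [xs [xs1 xs2]] : exists f : nat -> G, (forall i, (H `&` Psi psi) (f i)) /\
    forall a, (H `&` Psi psi) a -> exists i, f i = a.
  apply: countable_enum; first by apply: sub_countable cntH; apply: subset_card_le => ? [].
  by exists (succ psi c); split; [exact: Hs|have [] := succP HT c].
have [S1 [cS1 sub1 tot1 dom1]] := add_Psi_seq HT sI cS (fun i => (xs1 i).2).
have {}dom1 := dom1 H cH SH (fun i => (xs1 i).1).
have tot x : H x -> Psi psi x -> exists y, S1 x y.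
  by move=> h1 h2; have [i <-] := xs2 x (conj h1 h2); exact: tot1.
case: (pselect (exists g, S1 c g)) => [[g hg]|/forallNP nc]; first by exists S1, g.
have [|g hg] := realize_matches HT sI cS1 nc.
  move=> a b hab; apply: tot; first by apply: Hp; apply: HB => //; exact: dom1 hab.
  by apply: psi_Psi; rewrite subr_eq0; apply/eqP => e; apply: (nc b); rewrite e.
exists (rank_one_ext S1 c g), g; split.
- apply: (cgood_ext cS1 (rank_one_good HT cS1.1 cH dom1 Hc tot hg)).
  by move=> K u u'; exact: rank_one_closed.
- by move=> a b /sub1; exact: rank_one_sub.
- by apply: (rank_one_new _ _ cS1.1).
Qed.

Lemma cgood_sym S : cgood psi S -> cgood psi (fun a b => S b a).
Proof.
move=> [gS cS]; split; first exact: good_sym.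
have -> : [set p : G * G | S p.2 p.1] =
    [set (p.2, p.1) | p in [set p : G * G | S p.1 p.2]].
  by apply/seteqP; split=> [[a b] h|[a b] [[c d] h [<- <-]]] //; exists (b, a).
exact: (sub_countable (card_image_le _ _)).
Qed.

Lemma saturated_elementary (V : Type) (phi : formula L_log V) S
    (e e' : V -> log_structure psi) : cgood psi S ->
  (forall v, fvars phi v -> opt_rel S (e v) (e' v)) -> sat phi e <-> sat phi e'.
Proof.
apply: (@back_and_forth _ _ HT (cgood psi)) => {V phi S e e'} [S []//|S a cS|S b cS].
  exact: cgood_forth.
have [S' [a [c1 c2 c3]]] := cgood_forth b (cgood_sym cS).
exists (fun x y => S' y x), a; split=> //; first exact: cgood_sym.
by move=> x y; exact: c2.
Qed.

End SaturatedElementarity.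

(** * Ultrapowers *)

Section Ultrafilters.
Variables (U : set_system nat) (UF : UltraFilter U).

Lemma ultraC (A : set nat) : U (~` A) <-> ~ U A.
Proof.
split=> [h1 h2|h]; last by case: (in_ultra_setVsetC A UF).
have : U (~` A `&` A) by exact: filterI.
by rewrite setICl; exact: filter_not_empty.
Qed.

Lemma ultra_disj (A B : set nat) : U A -> U B -> (forall k, A k -> B k -> False) -> False.
Proof.
move=> h1 h2 h; apply: (@filter_not_empty _ U).
by apply: filterS2 h1 h2 => k; exact: h.
Qed.

Lemma ultra_imp (A B : set nat) : (U A -> U B) <-> U [set k | A k -> B k].
Proof.
split=> [h|h hA]; last by apply: filterS2 h hA => k; apply.
case: (in_ultra_setVsetC A UF) => hA; first by apply: filterS (h hA) => k /= hB _.
by apply: filterS hA => k /= hn /hn.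
Qed.

End Ultrafilters.

Section UltraPower.
Variables (G : orderedZmodType) (U : set_system nat) (UF : UltraFilter U).
Implicit Types f g h : nat -> G.

Definition ueq f g : bool := `[< U [set k | f k = g k] >].

Lemma ueq_equiv : equiv_class_of ueq.
Proof.
split.
- by move=> f; apply/asboolP/filterE => k.
- by move=> f g; apply/asboolP/asboolP => h; apply: filterS h => k /= ->.
- by move=> g f h /asboolP h1 /asboolP h2; apply/asboolP; apply: filterS2 h1 h2 => k /= -> ->.
Qed.

Canonical ueq_equiv_rel := EquivRelPack ueq_equiv.

Definition upow := {eq_quot ueq}.

HB.instance Definition _ := Choice.on upow.
HB.instance Definition _ := EqQuotient.on upow.

Definition upi f : upow := \pi_upow f.

Definition urepr (x : upow) : nat -> G := repr x.

Lemma ureprK x : upi (urepr x) = x.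
Proof. exact: reprK. Qed.

Lemma upi_eq f g : upi f = upi g <-> U [set k | f k = g k].
Proof. by split=> [/eqmodP/asboolP|h]; [|apply/eqmodP/asboolP]. Qed.

Lemma urepr_pi f : U [set k | urepr (upi f) k = f k].
Proof. by apply/upi_eq; rewrite ureprK. Qed.

Definition uadd (x y : upow) := upi (fun k => urepr x k + urepr y k).
Definition uopp (x : upow) := upi (fun k => - urepr x k).
Definition uzero := upi (fun _ => 0).

Lemma uaddE f g : uadd (upi f) (upi g) = upi (fun k => f k + g k).
Proof. by apply/upi_eq; apply: filterS2 (urepr_pi f) (urepr_pi g) => k /= -> ->. Qed.

Lemma uoppE f : uopp (upi f) = upi (fun k => - f k).
Proof. by apply/upi_eq; apply: filterS (urepr_pi f) => k /= ->. Qed.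

Lemma uaddA : associative uadd.
Proof.
move=> x y z; rewrite -[x]ureprK -[y]ureprK -[z]ureprK !uaddE.
by apply/upi_eq/filterE => k /=; rewrite addrA.
Qed.

Lemma uaddC : commutative uadd.
Proof.
move=> x y; rewrite -[x]ureprK -[y]ureprK !uaddE.
by apply/upi_eq/filterE => k /=; rewrite addrC.
Qed.

Lemma uadd0 : left_id uzero uadd.
Proof.
move=> x; rewrite -[x]ureprK !uaddE.
by apply/upi_eq/filterE => k /=; rewrite add0r.
Qed.

Lemma uaddN : left_inverse uzero uopp uadd.
Proof.
move=> x; rewrite -[x]ureprK uoppE !uaddE.
by apply/upi_eq/filterE => k /=; rewrite addNr.
Qed.

HB.instance Definition _ := GRing.isZmodule.Build upow uaddA uaddC uadd0 uaddN.

Definition ule (x y : upow) : bool := `[< U [set k | urepr x k <= urepr y k] >].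

Lemma uleE f g : ule (upi f) (upi g) <-> U [set k | f k <= g k].
Proof.
split=> [/asboolP h|h]; last apply/asboolP;
  by apply: filterS3 (urepr_pi f) (urepr_pi g) h => k /= -> ->.
Qed.

Lemma ule_refl : reflexive ule.
Proof. by move=> x; apply/asboolP/filterE => k /=. Qed.

Lemma ule_anti : antisymmetric ule.
Proof.
move=> x y; rewrite -[x]ureprK -[y]ureprK => /andP[/uleE h1 /uleE h2].
by apply/upi_eq; apply: filterS2 h1 h2 => k /= l1 l2; apply/le_anti; rewrite l1.
Qed.

Lemma ule_trans : transitive ule.
Proof.
move=> y x z; rewrite -[x]ureprK -[y]ureprK -[z]ureprK => /uleE h1 /uleE h2.
by apply/uleE; apply: filterS2 h1 h2 => k /=; apply: le_trans.
Qed.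

HB.instance Definition _ :=
  Order.Le_isPOrder.Build ring_display upow ule_refl ule_anti ule_trans.

Lemma ule_total (x y : upow) : (x <= y) || (y <= x).
Proof.
rewrite -[x]ureprK -[y]ureprK; apply/orP.
case: (in_ultra_setVsetC [set k | urepr x k <= urepr y k] UF) => h; [left|right]; apply/uleE => //.
by apply: filterS h => k /= /negP l; case/orP: (og_total (urepr x k) (urepr y k)) => // l'; rewrite l' in l.
Qed.

Lemma ule_add2l (z x y : upow) : x <= y -> z + x <= z + y.
Proof.
rewrite -[x]ureprK -[y]ureprK -[z]ureprK => /uleE h.
rewrite [_ + _]uaddE [X in _ <= X]uaddE; apply/uleE; apply: filterS h => k /=.
by rewrite og_leD2l.
Qed.

HB.instance Definition _ := POrderedZmodule_isOrdered.Build upow ule_total ule_add2l.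

Lemma upi_le f g : upi f <= upi g <-> U [set k | f k <= g k].
Proof. exact: uleE. Qed.

Lemma upi_lt f g : upi f < upi g <-> U [set k | f k < g k].
Proof.
rewrite og_ltNge; split=> [/negP h|h].
  have : U (~` [set k | g k <= f k]) by apply/ultraC => h'; apply/h/upi_le.
  by apply: filterS => k /=; rewrite og_ltNge => /negP.
apply/negP => /upi_le h'; apply: (ultra_disj UF h h') => k /= l1 l2.
by have := lt_le_trans l1 l2; rewrite ltxx.
Qed.

Lemma upi_neq f g : upi f != upi g <-> U [set k | f k != g k].
Proof.
split=> [/eqP h|h]; last first.
  apply/eqP => /upi_eq h'; by apply: (ultra_disj UF h h') => k /= /eqP.
have : U (~` [set k | f k = g k]) by apply/ultraC => h'; apply/h/upi_eq.
by apply: filterS => k /= /eqP.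
Qed.

Lemma upiD f g : upi f + upi g = upi (fun k => f k + g k).
Proof. exact: uaddE. Qed.

Lemma upiN f : - upi f = upi (fun k => - f k).
Proof. exact: uoppE. Qed.

Lemma upiMn f n : upi f *+ n = upi (fun k => f k *+ n).
Proof.
elim: n => [|n IH]; first by rewrite mulr0n.
by rewrite mulrS IH upiD; apply/upi_eq/filterE => k /=; rewrite mulrS.
Qed.

Lemma upiMz f (m : int) : upi f *~ m = upi (fun k => f k *~ m).
Proof.
case: m => n; first by rewrite -pmulrn upiMn.
by rewrite NegzE mulrNz -pmulrn upiMn upiN; apply/upi_eq/filterE => k /=; rewrite mulrNz -pmulrn.
Qed.

Lemma upi_neq0 f : upi f != 0 <-> U [set k | f k != 0].
Proof. exact: upi_neq. Qed.

Lemma upi_surj (x : upow) : exists f, x = upi f.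
Proof. by exists (urepr x); rewrite ureprK. Qed.

End UltraPower.

Section UltraModel.
Variables (G : orderedZmodType) (psi : G -> G).
Hypothesis HT : model_T0 psi.
Variables (U : set_system nat) (UF : UltraFilter U).
Implicit Types f g h : nat -> G.

Local Notation GU := (upow G UF).
Local Notation upi := (upi UF).

Definition upsi (x : GU) : GU := upi (fun k => psi (urepr x k)).

Lemma upsiE f : upsi (upi f) = upi (fun k => psi (f k)).
Proof. by apply/upi_eq; apply: filterS (urepr_pi UF f) => k /= ->. Qed.

Lemma upsi_couple : asymptotic_couple upsi.
Proof.
split.
- move=> a b; have [f ->] := upi_surj a; have [g ->] := upi_surj b.
  rewrite upiD !upsiE => /upi_neq0 h1 /upi_neq0 h2 /upi_neq0 h3.
  have h : U [set k | Order.min (psi (f k)) (psi (g k)) <= psi (f k + g k)].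
    by apply: filterS3 h1 h2 h3 => k /=; apply: (ac1 (T0_couple HT)).
  rewrite minEle; case: ifPn => [/upi_le hle|]; first apply/upi_le.
    by apply: filterS2 h hle => k /= hk l; move: hk; rewrite minEle l.
  rewrite -og_ltNge => /upi_lt hle; apply/upi_le.
  by apply: filterS2 h hle => k /= hk l; move: hk; rewrite minEle [psi (f k) <= psi (g k)]og_leNgt l.
- move=> a r; have [f ->] := upi_surj a => /upi_neq0 h1 h2.
  by rewrite upiMz !upsiE; apply/upi_eq; apply: filterS h1 => k /= n0; rewrite psi_mulz.
- move=> a b; have [f ->] := upi_surj a; have [g ->] := upi_surj b.
  rewrite !upsiE upiD => /upi_neq0 h1 /upi_neq0 h2 /upi_lt h3; apply/upi_lt.
  by apply: filterS3 h1 h2 h3 => k /=; apply: (ac3 (T0_couple HT)).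
Qed.

Lemma upsi_integral f : integral upsi (upi f) = upi (fun k => integral psi (f k)).
Proof.
set P := [set b | b != 0 /\ der upsi b = upi f].
have P1 : P (upi (fun k => integral psi (f k))).
  split; first by apply/upi_neq0/filterE => k /=; have [] := integralP HT (f k).
  rewrite /der upsiE upiD; apply/upi_eq/filterE => k /=.
  by have [] := integralP HT (f k).
have : P (integral upsi (upi f)) by apply: xgetPex; eexists; exact: P1.
have [h ->] := upi_surj (integral upsi (upi f)).
move=> [/upi_neq0 h1]; rewrite /der upsiE upiD => /upi_eq h2; apply/upi_eq.
apply: filterS2 h1 h2 => k /= n0 e; have [n1 e1] := integralP HT (f k).
by apply: (der_inj HT) => //; rewrite e1.
Qed.

Lemma upsi_succ f : succ upsi (upi f) = upi (fun k => succ psi (f k)).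
Proof. by rewrite /succ upsi_integral upsiE. Qed.

Lemma upsi_Psi f : Psi upsi (upi f) <-> U [set k | Psi psi (f k)].
Proof.
split=> [[a /= na]|hU].
  have [h e] := upi_surj a; move: na; rewrite e upsiE => /upi_neq0 n0 /upi_eq.
  by move=> h'; apply: filterS2 n0 h' => k /= n0 <-; exists (h k).
have hc k : exists b, Psi psi (f k) -> b != 0 /\ psi b = f k.
  case: (pselect (Psi psi (f k))) => [[b hb e]|hn]; last by exists 0.
  by exists b.
have [h {}hc] := choice hc; exists (upi h).
  by apply/upi_neq0; apply: filterS hU => k /= /hc[].
by rewrite upsiE; apply/upi_eq; apply: filterS hU => k /= /hc[].
Qed.

Lemma upsi_s0 : succ upsi 0 = upi (fun _ => succ psi 0).
Proof. exact: upsi_succ. Qed.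

Lemma upsi_model : model_T0 upsi.
Proof.
split; rewrite ?upsi_s0.
- exact: upsi_couple.
- move=> a b; have [f ->] := upi_surj a; have [g ->] := upi_surj b.
  rewrite !upsiE => /upi_lt h1 /upi_le h2; apply/upi_le.
  by apply: filterS2 h1 h2 => k /=; apply: (T0_H_type HT).
- move=> [//|n] a _; have [f ->] := upi_surj a.
  exists (upi (fun k => div_by n.+1 (f k))); rewrite upiMn; apply/upi_eq/filterE => k /=.
  exact: div_byK HT n (f k).
- apply/seteqP; split=> // a _; have [f ->] := upi_surj a.
  exists (upi (fun k => integral psi (f k))).
    by apply/upi_neq0/filterE => k /=; have [] := integralP HT (f k).
  rewrite /der upsiE upiD; apply/upi_eq/filterE => k /=.
  by have [] := integralP HT (f k).
- by apply/upsi_Psi/filterE => k /=; exact: T0_s0_Psi.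
- move=> a; have [f ->] := upi_surj a => /upsi_Psi h; apply/upi_le.
  by apply: filterS h => k /=; exact: T0_s0_least.
- by apply/upi_lt/filterE => k /=; exact: T0_s0_gt0.
- move=> a; have [f ->] := upi_surj a => /upsi_Psi h; rewrite upsi_succ; split.
  + by apply/upsi_Psi; apply: filterS h => k /=; exact: Psi_succ.
  + by apply/upi_lt; apply: filterS h => k /=; exact: lt_succ.
  + move=> b; have [g ->] := upi_surj b => /upsi_Psi hg /upi_lt l; apply/upi_le.
    by apply: filterS3 h hg l => k /= p1 p2; rewrite succ_le.
- split.
  + move=> a /=; have [f ->] := upi_surj a => /upsi_Psi h; rewrite upsi_succ.
    split; first by apply/upsi_Psi; apply: filterS h => k /=; exact: Psi_succ.
    rewrite /= upsi_s0; apply/upi_lt; apply: filterS h => k /= p.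
    by apply: le_lt_trans (lt_succ HT p); exact: T0_s0_least.
  + move=> a b; rewrite !inE; have [f ->] := upi_surj a; have [g ->] := upi_surj b.
    move=> /upsi_Psi h1 /upsi_Psi h2; rewrite !upsi_succ => /upi_eq h3; apply/upi_eq.
    by apply: filterS3 h1 h2 h3 => k /=; exact: succ_inj.
  + move=> a /= []; have [f ->] := upi_surj a => /upsi_Psi h1 /=; rewrite upsi_s0 => /upi_lt h2.
    exists (upi (fun k => pred_Psi psi (f k))).
      by apply/upsi_Psi; apply: filterS2 h1 h2 => k /= p l; have [] := predP HT p l.
    rewrite upsi_succ; apply/upi_eq.
    by apply: filterS2 h1 h2 => k /= p l; have [] := predP HT p l.
Qed.

Lemma upsi_pred f : Psi upsi (upi f) -> succ upsi 0 < upi f ->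
  pred_Psi upsi (upi f) = upi (fun k => pred_Psi psi (f k)).
Proof.
move=> /upsi_Psi h1; rewrite upsi_s0 => /upi_lt h2.
apply: (pred_eq upsi_model).
  by apply/upsi_Psi; apply: filterS2 h1 h2 => k /= p l; have [] := predP HT p l.
rewrite upsi_succ; apply/upi_eq.
by apply: filterS2 h1 h2 => k /= p l; have [] := predP HT p l.
Qed.

Lemma upsi_div n f : div_by n.+1 (upi f) = upi (fun k => div_by n.+1 (f k)).
Proof.
apply: (div_by_eq upsi_model); rewrite upiMn; apply/upi_eq/filterE => k /=.
exact: div_byK HT n (f k).
Qed.

(** Relates points of the ultrapower with infinity to sequences with infinity: the ultrafilter
    decides which sequences are infinite, and no quotient of [option G] has to be formed. *)
Definition urel (o : option GU) (s : nat -> option G) : Prop :=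
  if o is Some x then exists2 f, x = upi f & U [set k | s k = Some (f k)]
  else U [set k | s k = None].

Lemma urel_ex (s : nat -> option G) : exists o, urel o s.
Proof.
case: (in_ultra_setVsetC [set k | s k = None] UF) => h; first by exists None.
exists (Some (upi (fun k => odflt 0 (s k)))); exists (fun k => odflt 0 (s k)) => //.
by apply: filterS h => k /=; case: (s k).
Qed.

Lemma urel_seq (o : option GU) : exists s, urel o s.
Proof.
case: o => [x|]; last by exists (fun _ => None); apply/filterE.
have [f ->] := upi_surj x; exists (fun k => Some (f k)); exists f => //.
by apply: filterE.
Qed.

Lemma urel_cases (o : option GU) s : urel o s ->
  (o = None /\ U [set k | s k = None]) \/
  exists f, o = Some (upi f) /\ U [set k | s k = Some (f k)].
Proof. by case: o => [x [f -> h]|h]; [right; exists f|left]. Qed.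

Lemma urel_Some f s : U [set k | s k = Some (f k)] -> urel (Some (upi f)) s.
Proof. by exists f. Qed.

Lemma urel_eval (V : Type) (t : term L_log V) (e : V -> log_structure upsi)
    (ek : nat -> V -> log_structure psi) :
  (forall v, urel (e v) (fun k => ek k v)) ->
  urel (eval e t) (fun k => eval (ek k) t).
Proof.
move=> he; elim: t => [v|F ts IH] //=.
case: F ts IH => [||||||| n] ts IH /=; rewrite /log_fint.
- by apply: (@urel_Some (fun=> 0)); exact: filterE.
- have [[-> h1]|[f [-> h1]]] := urel_cases (IH ord0).
    by apply: filterS h1 => k /= ->.
  have [[-> h2]|[g [-> h2]]] := urel_cases (IH ord_max).
    by apply: filterS2 h1 h2 => k /= -> ->.
  by rewrite upiD; apply: urel_Some; apply: filterS2 h1 h2 => k /= -> ->.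
- have [[-> h1]|[f [-> h1]]] := urel_cases (IH ord0).
    by apply: filterS h1 => k /= ->.
  by rewrite /= upiN; apply: urel_Some; apply: filterS h1 => k /= ->.
- have [[-> h1]|[f [-> h1]]] := urel_cases (IH ord0).
    by apply: filterS h1 => k /= ->.
  rewrite /=; case: ifPn => [/eqP/upi_eq h2|/upi_neq0 h2].
    by apply: filterS2 h1 h2 => k /= -> /= ->; rewrite eqxx.
  by rewrite upsiE; apply: urel_Some; apply: filterS2 h1 h2 => k /= -> /= /negPf ->.
- exact: filterE.
- have [[-> h1]|[f [-> h1]]] := urel_cases (IH ord0).
    by apply: filterS h1 => k /= ->.
  by rewrite /= upsi_succ; apply: urel_Some; apply: filterS h1 => k /= ->.
- have [[-> h1]|[f [-> h1]]] := urel_cases (IH ord0).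
    by apply: filterS h1 => k /= ->.
  have iff : Psi_gt_s0 upsi (upi f) <-> U [set k | Psi_gt_s0 psi (f k)].
    split=> [[/upsi_Psi h2 /=]|h2].
      by rewrite upsi_s0 => /upi_lt h3; apply: filterS2 h2 h3.
    split; first by apply/upsi_Psi; apply: filterS h2 => k [].
    by rewrite /= upsi_s0; apply/upi_lt; apply: filterS h2 => k [].
  rewrite /=; case: ifPn; rewrite ?inE ?notin_setE => h2.
    rewrite upsi_pred; [|by case: h2|by case: h2].
    move/iff: h2 => h2; apply: urel_Some; apply: filterS2 h1 h2 => k /= -> /= h3.
    by rewrite mem_set.
  have h3 : U (~` [set k | Psi_gt_s0 psi (f k)]) by apply/ultraC => /iff.
  by apply: filterS2 h1 h3 => k /= -> /= h4; rewrite memNset.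
- have [[-> h1]|[f [-> h1]]] := urel_cases (IH ord0).
    by apply: filterS h1 => k /= ->.
  by rewrite /= upsi_div; apply: urel_Some; apply: filterS h1 => k /= ->.
Qed.

Lemma urel_fun o s o' s' : urel o s -> urel o' s' ->
  o = o' <-> U [set k | s k = s' k].
Proof.
move=> /urel_cases [[-> h1]|[f [-> h1]]] /urel_cases [[-> h2]|[g [-> h2]]].
- by split=> // _; apply: filterS2 h1 h2 => k /= -> ->.
- split=> // h3; exfalso; have h4 : U [set k | None = Some (g k)].
    by apply: filterS3 h1 h2 h3 => k /= <- <-.
  by apply: (ultra_disj UF h4 h4) => k.
- split=> // h3; exfalso; have h4 : U [set k | None = Some (f k)].
    by apply: filterS3 h1 h2 h3 => k /= <- <-.
  by apply: (ultra_disj UF h4 h4) => k.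
- split=> [[/upi_eq h3]|h3]; first by apply: filterS3 h1 h2 h3 => k /= -> -> ->.
  congr Some; apply/upi_eq.
  by apply: filterS3 h1 h2 h3 => k /= -> -> [].
Qed.

Lemma urel_lt o s o' s' : urel o s -> urel o' s' ->
  lt_infty o o' <-> U [set k | lt_infty (s k) (s' k)].
Proof.
move=> /urel_cases [[-> h1]|[f [-> h1]]] /urel_cases [[-> h2]|[g [-> h2]]] /=.
- split=> // h3; apply: (ultra_disj UF h1 h3) => k /= ->.
  by [].
- split=> // h3; apply: (ultra_disj UF h1 h3) => k /= ->.
  by [].
- by split=> // _; apply: filterS2 h1 h2 => k /= -> ->.
- split=> [/upi_lt h3|h3]; first by apply: filterS3 h1 h2 h3 => k /= -> ->.
  by apply/upi_lt; apply: filterS3 h1 h2 h3 => k /= -> ->.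
Qed.

Lemma los (V : Type) (phi : formula L_log V) (e : V -> log_structure upsi)
    (ek : nat -> V -> log_structure psi) :
  (forall v, urel (e v) (fun k => ek k v)) ->
  sat phi e <-> U [set k | sat phi (ek k)].
Proof.
elim: phi e ek => {V} [V|V t u|V P ts|V p IHp q IHq|V p IHp] e ek he /=.
- by split=> // h; apply: (ultra_disj UF h h) => k.
- exact: urel_fun (urel_eval t he) (urel_eval u he).
- case: P ts => ts; exact: urel_lt (urel_eval _ he) (urel_eval _ he).
- have h1 := IHp e ek he; have h2 := IHq e ek he.
  split=> [h|h /h1 h3]; first by apply/(ultra_imp UF) => /h1 /h /h2.
  by apply/h2; move: h3; apply/(ultra_imp UF).
- have ext o s : urel o s -> forall v, urel (if v is Some x then e x else o)
      (fun k => if v is Some x then ek k x else s k).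
    by move=> ho [x|]; [exact: he|exact: ho].
  split=> [h|h o].
    case: (in_ultra_setVsetC [set k | forall a, sat p
      (fun v => if v is Some x then ek k x else a)] UF) => // hn; exfalso.
    (* A counterexample is chosen in each coordinate that has one; the resulting sequence represents
       a counterexample in the ultrapower. *)
    have hc k : exists a, (~ forall a, sat p (fun v => if v is Some x then ek k x else a)) ->
        ~ sat p (fun v => if v is Some x then ek k x else a).
      case: (pselect (exists a, ~ sat p (fun v => if v is Some x then ek k x else a))).
        by move=> [a ha]; exists a.
      by move=> hno; exists None => hna; case: hna => a; apply: contrapT => ha; apply: hno; exists a.
    have [s {}hc] := choice hc; have [o ho] := urel_ex s.
    have [/(_ (h o)) h1 _] := IHp _ (fun k v => if v is Some x then ek k x else s k) (ext _ _ ho).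
    by apply: (ultra_disj UF hn h1) => k /= hk; exact: hc hk.
  have [s ho] := urel_seq o.
  apply/(IHp _ (fun k v => if v is Some x then ek k x else s k) (ext _ _ ho)).
  by apply: filterS h => k /=; apply.
Qed.

Definition internal (A : set GU) : Prop := exists T : nat -> set G,
  forall f, A (upi f) <-> U [set k | T k (f k)].

Lemma upsi_saturated : (forall n, U [set k | (n <= k)%N]) -> saturated upsi internal.
Proof.
move=> Ucof; split.
- by exists (fun=> setT) => f; split=> // _; exact: filterE.
- move=> a; have [h ->] := upi_surj a.
  exists (fun k => [set y | Psi psi y /\ h k < y]) => f; split=> [[/upsi_Psi h1 /upi_lt h2]|h1].
    by apply: filterS2 h1 h2.
  by split; [apply/upsi_Psi|apply/upi_lt]; apply: filterS h1 => k [].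
- move=> a; have [h ->] := upi_surj a.
  exists (fun k => [set y | Psi psi y /\ y < h k]) => f; split=> [[/upsi_Psi h1 /upi_lt h2]|h1].
    by apply: filterS2 h1 h2.
  by split; [apply/upsi_Psi|apply/upi_lt]; apply: filterS h1 => k [].
- move=> a y b; have [h ->] := upi_surj a; have [z ->] := upi_surj y.
  exists (fun k => [set g | [/\ g != h k, (h k < g) = b & psi (g - h k) = z k]]) => f.
  have lt_iff : (upi h < upi f) = b <-> U [set k | (h k < f k) = b].
    case: b; first exact: upi_lt.
    split=> [/negbT|h1]; first by rewrite -og_leNgt => /upi_le; apply: filterS => k /=; rewrite og_leNgt => /negbTE.
    apply/negbTE; rewrite -og_leNgt; apply/upi_le; apply: filterS h1 => k /= /negbT.
    by rewrite og_leNgt.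
  rewrite /= upiN upiD upsiE; split=> [[/upi_neq h1 /lt_iff h2 /upi_eq h3]|h1].
    by apply: filterS3 h1 h2 h3.
  by split; [apply/upi_neq|apply/lt_iff|apply/upi_eq]; apply: filterS h1 => k [].
- move=> D hD fip; have [T hT] := choice hD.
  (* In coordinate [k], [f] meets as many initial conditions as possible. The bound [n <= k] makes a
     maximum exist and, for each fixed [n], holds for almost all [k]. *)
  pose P k n := (n <= k)%N /\ exists x, forall i, (i < n)%N -> T i k x.
  have P0 k : P k 0%N by split=> //; exists 0.
  have hc k : exists x, forall n, P k n -> forall i, (i < n)%N -> T i k x.
    have [n [[hn [x hx]] hmax]] : exists n, P k n /\ forall m, P k m -> (m <= n)%N.
      have hex : exists n, `[< P k n >] by exists 0%N; apply/asboolP.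
      have hub n : `[< P k n >] -> (n <= k)%N by move=> /asboolP[].
      exists (ex_maxn hex hub); case: ex_maxnP => n /asboolP hn hmax; split=> // m hm.
      by apply: hmax; apply/asboolP.
    exists x => m hm i him; apply: hx; apply: leq_trans him _; exact: hmax.
  have [f hf] := choice hc; exists (upi f) => i; apply/hT.
  have [x hx] := fip i.+1; have [g eg] := upi_surj x.
  have h1 : U [set k | forall j, (j < i.+1)%N -> T j k (g k)].
    elim: (i.+1) hx => [_|n IH hx]; first by apply: filterE.
    have := IH (fun j hj => hx j (ltnW hj)); have := hx n (leqnn _).
    rewrite eg => /hT h1 h2; apply: filterS2 h1 h2 => k /= t1 t2 j.
    by rewrite ltnS leq_eqVlt => /predU1P[->|/t2].
  apply: filterS2 h1 (Ucof i.+1) => k /= t1 t2.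
  by apply: (hf k i.+1) => //; split=> //; exists (g k).
Qed.

End UltraModel.

(** * Definability in Psi *)

Section Definability.
Variables (L : language) (M : structure L) (m : nat).
Implicit Types D E : set ('I_m -> M).

Lemma definable_setT : definable (setT : set ('I_m -> M)).
Proof. by exists (Imp (Bot L _) (Bot L _)) => x; split=> // _ h; exact: h. Qed.

Lemma definable_setC D : definable D -> definable (~` D).
Proof.
move=> [p hp]; exists (Imp p (Bot L _)) => x /=.
by split=> h h'; apply: h; apply/hp.
Qed.

Lemma definable_setU D E : definable D -> definable E -> definable (D `|` E).
Proof.
move=> [p hp] [q hq]; exists (Imp (Imp p (Bot L _)) q) => x /=; split.
  by move=> [/hp h1 /(_ h1)|/hq h1 _].
move=> h; case: (pselect (D x)) => hx; first by left.
by right; apply/hq/h => /hp.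
Qed.

Lemma definable_setI D E : definable D -> definable E -> definable (D `&` E).
Proof.
move=> h1 h2; rewrite -[D `&` E]setCK setCI.
by apply/definable_setC/definable_setU; exact: definable_setC.
Qed.

(** [D] is a Boolean combination of the [Q j]. The induction splits [D] along [Q j] and saturates
    each piece under agreement on the remaining indices, which gives the sets [D']. *)
Lemma definable_invariant (J : eqType) (Q : J -> set ('I_m -> M)) (s : seq J) D :
  (forall j, definable (Q j)) ->
  (forall x y, (forall j, j \in s -> Q j x <-> Q j y) -> D x -> D y) ->
  definable D.
Proof.
move=> hQ; elim: s D => [|j s IH] D hD.
  case: (pselect (D !=set0)) => [[x hx]|hn].
    have -> : D = setT by apply/seteqP; split=> // y _; exact: hD hx.
    exact: definable_setT.
  have -> : D = ~` setT by apply/seteqP; split=> y hy; [case: hn; exists y|case: hy].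
  exact/definable_setC/definable_setT.
pose D' (P : set ('I_m -> M)) := [set y | exists x, [/\ D x, P x &
  forall i, i \in s -> Q i x <-> Q i y]].
have dD' P : definable (D' P).
  apply: IH => x y hxy [z [h1 h2 h3]]; exists z; split=> // i hi.
  by rewrite (h3 i hi) (hxy i hi).
have -> : D = (Q j `&` D' (Q j)) `|` (~` Q j `&` D' (~` Q j)).
  apply/seteqP; split=> y.
    by case: (pselect (Q j y)) => hq hy; [left|right]; split=> //; exists y; split.
  have ext x : D x -> (Q j x <-> Q j y) ->
      (forall i, i \in s -> Q i x <-> Q i y) -> D y.
    by move=> hx hj hs; apply: hD hx => i; rewrite inE => /predU1P[->|/hs].
  move=> [[hq [x [h1 h2 h3]]]|[hq [x [h1 h2 h3]]]]; apply: ext h1 _ h3;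
    by split=> // /hq.
by apply: definable_setU; apply: definable_setI => //; exact: definable_setC.
Qed.

End Definability.

Lemma countable_bigcup_ord (T : Type) (n : nat) (F : 'I_n -> set T) :
  (forall i, countable (F i)) -> countable (\bigcup_i F i).
Proof. by move=> hF; apply: bigcup_countable => // i _; exact: hF. Qed.

Lemma countable_tvars (L : language) (V : Type) (t : term L V) : countable (tvars t).
Proof.
elim: t => [x|F ts IH] /=; first exact: countable1.
exact: countable_bigcup_ord.
Qed.

Lemma countable_fvars (L : language) (V : Type) (phi : formula L V) :
  countable (fvars phi).
Proof.
elim: phi => {V} [V|V t u|V P ts|V p IHp q IHq|V p IHp] /=.
- exact: countable0.
- by apply: countable_setU; exact: countable_tvars.
- by apply: countable_bigcup_ord => i; exact: countable_tvars.
- exact: countable_setU.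
- move/countable_injP: IHp => [f hf]; apply/countable_injP.
  exists (f \o some) => x y; rewrite !inE /= => hx hy e.
  by have := hf (Some x) (Some y); rewrite !inE => /(_ hx hy e)[].
Qed.

Section PsiDefinability.
Variables (G : orderedZmodType) (psi : G -> G).
Hypothesis HT : model_T0 psi.
Local Notation succ := (succ psi).

Definition flt (V : Type) (u v : V) : formula L_lt V :=
  @Rel L_lt V RLt (fun i => @Var L_lt V (if i == ord0 then u else v)).

(** Expresses [s^j u <= v] without a symbol for [s]: [s^(j+1) u <= v] holds iff some [c > u]
    satisfies [s^j c <= v]. *)
Fixpoint fle (V : Type) (j : nat) (u v : V) : formula L_lt V :=
  match j with
  | 0%N => Imp (flt v u) (Bot L_lt V)
  | j'.+1 => Imp (All (Imp (flt (Some u) None)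
                         (Imp (fle j' None (Some v)) (Bot L_lt _)))) (Bot L_lt V)
  end.

Lemma iter_leS j (a b : G) : Psi psi a -> Psi psi b -> a <= b ->
  iter j succ a <= iter j succ b.
Proof. by move=> ha hb hab; elim: j => //= j IH; rewrite succ_mono_le //; apply: iter_Psi. Qed.

Lemma sat_fle (V : Type) (j : nat) (u v : V) (e : V -> Psi_structure psi) :
  sat (fle j u v) e <-> iter j succ (val (e u)) <= val (e v).
Proof.
elim: j V u v e => [|j IH] V u v e /=.
  by rewrite og_leNgt; split=> [h|/negP]; [apply/negP|].
have pu := set_valP (e u); have pv := set_valP (e v).
split=> [h|h].
  apply: contrapT => hn; apply: h => c /= hc /IH /= h; apply: hn.
  apply: le_trans h; rewrite -iterS iterSr; have pc := set_valP c.
  by apply: iter_leS; rewrite ?succ_le //; exact: Psi_succ.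
move=> hall; apply: (hall (SigSub (mem_set (Psi_succ HT pu)))) => /=.
  exact: lt_succ.
by apply/IH; rewrite /= -iterSr.
Qed.

Lemma definable_le m (t t' : 'I_m + Psi_structure psi) (j : nat) :
  definable [set x : 'I_m -> Psi_structure psi |
    iter j succ (val (match t with inl i => x i | inr a => a end)) <=
    val (match t' with inl i => x i | inr a => a end)].
Proof. by exists (fle j t t') => x; rewrite sat_fle. Qed.

End PsiDefinability.

(** * Tuples satisfying the same order conditions *)

Section SimilarTuples.
Variables (G : orderedZmodType) (psi : G -> G).
Hypothesis HT : model_T0 psi.
Local Notation succ := (succ psi).
Implicit Types (t u x y : G) (S P : G -> G -> Prop).

Variable P : G -> G -> Prop.
Hypotheses (PPsi : forall x y, P x y -> Psi psi x /\ Psi psi y)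
  (Ple : forall x y t u j, P x y -> P t u ->
    (iter j succ x <= t) = (iter j succ y <= u)).

(** Every element of [Psi] in the domain is tied by iterates of [s] to a pair of [P], so comparing
    it with a new coordinate reduces to the conditions [Ple]. *)
Definition generated S := forall a b, S a b -> Psi psi a ->
  exists t u, P t u /\ gal psi t u a b.

Lemma iter_add_le k (a b : G) : Psi psi a -> Psi psi b ->
  (iter k succ a <= iter k succ b) = (a <= b).
Proof. by move=> ha hb; elim: k => //= k IH; rewrite succ_mono_le //; apply: iter_Psi. Qed.

Lemma similar_le x y t u i j : P x y -> P t u ->
  (iter i succ x <= iter j succ t) = (iter i succ y <= iter j succ u).
Proof.
move=> h1 h2; have [px py] := PPsi h1; have [pt pu] := PPsi h2.
have Pit k v : Psi psi v -> Psi psi (iter k succ v) by exact: iter_Psi.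
case: (leqP j i) => hij.
  rewrite -(subnKC hij) !iterD !iter_add_le; try exact: Pit; try done.
  exact: Ple.
rewrite -(subnKC (ltnW hij)) !iterD !iter_add_le; try exact: Pit; try done.
(* The iterate is on the right side; negating, and absorbing strictness into one more successor,
   moves it to the left. *)
rewrite !og_leNgt -!(succ_le HT); try exact: Pit; try done.
by rewrite -!iterS (Ple _ h2 h1).
Qed.

Lemma extend_generated S x y : cgood psi S -> generated S -> P x y ->
  exists S', [/\ cgood psi S', generated S', forall a b, S a b -> S' a b & S' x y].
Proof.
move=> cS gen hxy; have [gS _] := cS; have [px py] := PPsi hxy.
(* If [x] is already in the domain, its image shares an iterate with [y], because both compare alike
   with the iterates of [u]. *)
case: (pselect (exists b, S x b)) => [[b hb]|/forallNP nx].
  have [t [u [htu [_ pb [i [j [e1 e2]]]]]]] := gen _ _ hb px.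
  exists S; split=> //; suff <- : b = y by [].
  apply: (iter_inj HT pb py (i := i)); rewrite e2; apply/le_anti.
  by rewrite -(similar_le _ _ htu hxy) -(similar_le _ _ hxy htu) e1 lexx.
have hc : same_cut psi S x y.
  move=> a b hab pa; have [t [u [htu [_ pb [i [j [e1 e2]]]]]]] := gen _ _ hab pa.
  have l1 : (a <= x) = (b <= y).
    by rewrite -(iter_add_le i) // -[RHS](iter_add_le i) // e1 e2; exact: similar_le.
  have l2 : (x <= a) = (y <= b).
    by rewrite -(iter_add_le i) // -[RHS](iter_add_le i) // e1 e2; exact: similar_le.
  have ne : a != x by apply/eqP => e; apply: (nx b); rewrite -e.
  case/orP: (og_total a x) => h; [left|right].
    have lt : a < x by rewrite lt_neqAle ne.
    by split=> //; rewrite og_ltNge -l2 -og_ltNge.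
  have lt : x < a by rewrite lt_neqAle eq_sym ne.
  by split=> //; rewrite og_ltNge -l1 -og_ltNge.
have [S' [gS' sub hS' hP hH]] := galaxy_extension HT gS px py hc.
exists S'; split=> //; first exact: cgood_ext cS gS' hH.
move=> a b hab pa; case: (hP _ _ hab pa) => [h|h]; first exact: gen h pa.
by exists x, y.
Qed.

Lemma extend_tuple S m (xs ys : 'I_m -> G) : cgood psi S -> generated S ->
  (forall i, P (xs i) (ys i)) ->
  exists S', [/\ cgood psi S', forall a b, S a b -> S' a b & forall i, S' (xs i) (ys i)].
Proof.
move=> cS gen hP.
have [S' [c1 _ c3 c4]] : exists S', [/\ cgood psi S', generated S',
    forall a b, S a b -> S' a b & forall i, i \in enum 'I_m -> S' (xs i) (ys i)].
  elim: (enum 'I_m) => [|i s [S' [c1 c2 c3 c4]]]; first by exists S.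
  have [S'' [d1 d2 d3 d4]] := extend_generated c1 c2 (hP i).
  exists S''; split=> // [a b /c3/d3//|k]; rewrite inE => /predU1P[->//|/c4/d3//].
by exists S'; split=> // i; apply: c4; rewrite mem_enum.
Qed.

End SimilarTuples.

(** * Stable embeddedness of Psi *)

Section StableEmbedding.
Variables (G : orderedZmodType) (psi : G -> G).
Hypothesis HT : model_T0 psi.
Local Notation succ := (succ psi).

Section Diagonal.
Variables (U : set_system nat) (UF : UltraFilter U).
Local Notation upi := (upi UF).
Local Notation upsi := (@upsi G psi U UF).

Definition diagonal (A : set G) (u u' : upow G UF) := exists a, [/\ A a,
  u = upi (fun=> a) & u' = upi (fun=> a)].

Lemma diagonal_cgood (A : set G) : A !=set0 -> countable A -> closed_sub psi A ->
  cgood upsi (diagonal A).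
Proof.
move=> [a0 A0] cA clA; have [HB Hd Hp Hs Hpr] := clA; split.
  split.
  - by exists (a0 - a0); split; [exact: HB|rewrite subrr|rewrite subrr].
  - move=> _ _ _ _ [a [ha -> ->]] [b [hb -> ->]]; exists (a - b).
    by rewrite upiN upiD; split=> //; exact: HB.
  - move=> n _ _ [a [ha -> ->]]; exists (div_by n.+1 a).
    by rewrite (upsi_div HT); split=> //; exact: Hd.
  - by move=> _ _ [a [ha -> ->]].
  - by move=> _ _ [a [ha -> ->]] _; exists (psi a); rewrite upsiE; split=> //; exact: Hp.
  - by move=> _ _ [a [ha -> ->]]; exists (succ a); rewrite (upsi_succ HT); split=> //; exact: Hs.
  - move=> _ _ [a [ha -> ->]] p _ l; exists (pred_Psi psi a).
    by rewrite (upsi_pred HT) //; split=> //; exact: Hpr.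
have -> : [set p : upow G UF * upow G UF | diagonal A p.1 p.2] =
    [set (upi (fun=> a), upi (fun=> a)) | a in A].
  apply/seteqP; split=> [[u v] /= [a [ha -> ->]]|[u v] [a ha [<- <-]]]; first by exists a.
  by exists a.
exact: (sub_countable (card_image_le _ _)).
Qed.

Lemma upsi_iter_succ f j :
  iter j (Defs.succ upsi) (upi f) = upi (fun k => iter j succ (f k)).
Proof. by elim: j => //= j ->; rewrite (upsi_succ HT). Qed.

End Diagonal.

Theorem Psi_stably_embedded m (D : set ('I_m -> log_structure psi)) :
  definable D ->
  definable [set x : 'I_m -> Psi_structure psi | D (fun i => Psi_incl (x i))].
Proof.
move=> [phi hphi]; set E := [set x : 'I_m -> Psi_structure psi | _].
pose C := [set c : G | fvars phi (inr (Some c))].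
have cC : countable C.
  move/countable_injP: (countable_fvars phi) => [f hf]; apply/countable_injP.
  exists (f \o (fun c : G => inr (Some c))) => x y; rewrite !inE /= => hx hy e.
  by have := hf (inr (Some x)) (inr (Some y)); rewrite !inE => /(_ hx hy e)[].
(* The constants of [phi] have to be fixed by the initial partial isomorphism, which is the identity
   on [A]; [0] makes [A] nonempty. *)
have [A [cA clA sA]] := countable_closure psi (countableU1 0 cC).
have A0 : A 0 by apply: sA; left.
have As0 : A (succ 0) by have [_ _ _ h _] := clA; exact: h.
have [d [d1 d2]] : exists d : nat -> Psi psi, (forall i, A (val (d i))) /\
    forall a, A a -> Psi psi a -> exists i, val (d i) = a.
  have [||d [d1 d2]] := @countable_enum _ (A `&` Psi psi).
  - by apply: sub_countable cA; apply: subset_card_le => ? [].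
  - by exists (succ 0); split=> //; exact: T0_s0_Psi.
  exists (fun i => SigSub (mem_set (d1 i).2)); split=> [i|a ha pa] /=; first by have [] := d1 i.
  by have [i <-] := d2 a (conj ha pa); exists i.
(* An index is a coordinate or the number of a constant, so that the conditions [Q] form a countable
   type and can be listed by [pickle]. *)
pose ev (x : 'I_m -> Psi_structure psi) (c : 'I_m + nat) : Psi psi :=
  match c with inl i => x i | inr l => d l end.
pose Q (q : ('I_m + nat) * ('I_m + nat) * nat) := [set x : 'I_m -> Psi_structure psi |
  iter q.2 succ (val (ev x q.1.1)) <= val (ev x q.1.2)].
have dQ q : definable (Q q).
  case: q => [[c1 c2] j].
  pose par c : 'I_m + Psi_structure psi :=
    match c with inl i => inl i | inr l => inr (d l) end.
  have := definable_le HT (par c1) (par c2) j; congr (definable _).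
  by apply/seteqP; split=> x; rewrite /Q /=; case: (c1) => ?; case: (c2) => ?.
apply: contrapT => nD.
(* Without such a pair [E] would be invariant under the first [k] conditions, hence definable. *)
have hxy k : exists xy : ('I_m -> Psi psi) * ('I_m -> Psi psi),
    [/\ forall q, (pickle q < k)%N -> Q q xy.1 <-> Q q xy.2, E xy.1 & ~ E xy.2].
  apply: contrapT => /forallNP hno; apply: nD.
  apply: (definable_invariant (Q := Q) (s := pmap unpickle (iota 0 k))) => // x y hs hx.
  apply: contrapT => hy; apply: (hno (x, y)); split=> // q hq; apply: hs.
  rewrite mem_pmap; apply/mapP; exists (pickle q); last by rewrite pickleK.
  by rewrite mem_iota.
have [xy {}hxy] := choice hxy.
(* The ultrafilter contains all cofinite sets, so each single condition holds alike for the two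
   tuples at almost all [k]. *)
have [U [UF Ucof]] := ultraFilterLemma eventually_filter.
have {}Ucof n : U [set k | (n <= k)%N] by apply: Ucof; exists n.
pose HU := upsi_model HT UF; pose sU := upsi_saturated psi UF Ucof.
pose cl (z : nat -> 'I_m -> Psi psi) c := upi UF (fun k => val (ev (z k) c)).
pose xs k := (xy k).1; pose ys k := (xy k).2.
pose P (t u : upow G UF) := exists c, t = cl xs c /\ u = cl ys c.
have PPsi t u : P t u -> Psi (@upsi G psi U UF) t /\ Psi (@upsi G psi U UF) u.
  by move=> [c [-> ->]]; split; apply/upsi_Psi/filterE => k /=; exact: set_valP.
have Ple t u t' u' j : P t u -> P t' u' ->
    (iter j (Defs.succ (@upsi G psi U UF)) t <= t') = (iter j (Defs.succ (@upsi G psi U UF)) u <= u').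
  move=> [c [-> ->]] [c' [-> ->]]; rewrite !(upsi_iter_succ UF).
  have h : U [set k | Q (c, c', j) (xs k) <-> Q (c, c', j) (ys k)].
    apply: filterS (Ucof (pickle (c, c', j)).+1) => k /= hk.
    by have [h _ _] := hxy k; exact: h.
  apply/idP/idP => /upi_le h'; apply/upi_le; apply: filterS2 h h' => k /= h1 h2; exact/h1.
have gen : generated (@upsi G psi U UF) P (@diagonal U UF A).
  move=> _ _ [a [ha -> ->]] pa.
  have pa' : Psi psi a.
    apply: contrapT => hn; move/upsi_Psi: pa => pa.
    exact: (ultra_disj UF pa pa) => k /=.
  have [l el] := d2 a ha pa'.
  exists (upi UF (fun=> a)), (upi UF (fun=> a)); split; last by split=> //; exists 0%N, 0%N.
  by exists (inr l); rewrite /cl /= el.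
have cd := diagonal_cgood UF (ex_intro _ 0 A0) cA clA.
have [S [cS sub hS]] := extend_tuple HU PPsi Ple cd gen
  (fun i => ex_intro _ (inl i) (conj erefl erefl))
  (xs := fun i => cl xs (inl i)) (ys := fun i => cl ys (inl i)).
pose env (z : nat -> 'I_m -> Psi psi) (v : 'I_m + option G) : option (upow G UF) :=
  match v with inl i => Some (cl z (inl i)) | inr a => omap (fun b => upi UF (fun=> b)) a end.
pose envk (z : nat -> 'I_m -> Psi psi) k (v : 'I_m + log_structure psi) : log_structure psi :=
  match v with inl i => Psi_incl (z k i) | inr a => a end.
have hlos z : sat phi (env z : _ -> log_structure (@upsi G psi U UF)) <->
    U [set k | sat phi (envk z k)].
  apply: los => // -[i|[a|]] /=.
  - by exists (fun k => val (z k i)) => //; exact: filterE.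
  - by exists (fun=> a) => //; exact: filterE.
  - exact: filterE.
have hiff := saturated_elementary HU sU (phi := phi) (e := env xs) (e' := env ys) cS.
have hx : sat phi (env xs : _ -> log_structure (@upsi G psi U UF)).
  by apply/hlos/filterE => k /=; have [_ h _] := hxy k; apply/hphi; exact: h.
have /hlos hy : sat phi (env ys : _ -> log_structure (@upsi G psi U UF)).
  apply/hiff => //; case=> [i|[a|]] //= hv.
  by apply: sub; exists a; split=> //; apply: sA; right.
apply: (ultra_disj UF hy hy) => k /= h _.
by have [_ _] := hxy k; apply; apply/hphi.
Qed.

End StableEmbedding.

Theorem theorem7p1 (G : orderedZmodType) (psi : G -> G)
    (HT : model_T0 psi) (n : nat) (hn : (1 <= n)%N)
    (f : ('I_n -> Psi psi) -> Psi psi) :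
  definable_fun (M := log_structure psi) (@Psi_incl G psi) f ->
  definable_fun (M := Psi_structure psi) (fun a : Psi psi => a) f.
Proof.
(* As [Psi_incl] is injective, the trace on [Psi] of the graph taken in the couple is the graph
   taken in [Psi]. *)
move=> /(Psi_stably_embedded HT); rewrite /definable_fun; congr (definable _).
have inj (a b : Psi psi) : Psi_incl a = Psi_incl b -> a = b.
  by move=> [/val_inj].
apply/seteqP; split=> v [x [h1 h2]]; exists x; split=> [i|].
- exact/inj/h1.
- exact/inj/h2.
- by rewrite h1.
- by rewrite h2.
Qed.
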